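(* Let $F_\infty\colon U_\infty\to V_\infty$ be the operator produced by the construction described in the context. Then $F_\infty$ satisfies the following condition ($G^*$), and therefore it has the Gurarii property. ($G^*$) For every $\varepsilon>0$, every nonexpansive linear operator $T\colon X\to Y$ between finite-dimensional Banach spaces, all subspaces $X_0\subseteq X$, $Y_0\subseteq Y$ with $T[X_0]\subseteq Y_0$, and all linear isometric embeddings $i\colon X_0\to U_\infty$, $j\colon Y_0\to V_\infty$ with $F_\infty\circ i=j\circ(T\restriction X_0)$, there exist $\varepsilon$-embeddings $i'\colon X\to U_\infty$ and $j'\colon Y\to V_\infty$ such that $\|i'\restriction X_0-i\|<\varepsilon$, $\|j'\restriction Y_0-j\|<\varepsilon$ and $F_\infty\circ i'=j'\circ T$.
   Context: All Banach spaces are real. An operator is a bounded linear operator; nonexpansive means of norm $\le 1$. An $\varepsilon$-embedding is a linear operator $f\colon X\to Y$ with $(1+\varepsilon)^{-1}\|x\|\le\|f(x)\|\le\|x\|$ for all $x\in X$. Gurarii property. A linear operator $\Omega\colon U\to V$ between Banach spaces has the Gurarii property if $\|\Omega\|\le 1$ and condition ($G$) holds: given $\varepsilon>0$, a nonexpansive operator $T\colon X\to Y$ between finite-dimensional spaces, subspaces $X_0\subseteq X$, $Y_0\subseteq Y$ with $T[X_0]\subseteq Y_0$, and isometric embeddings $i\colon X_0\to U$, $j\colon Y_0\to V$ with $\Omega\circ i=j\circ(T\restriction X_0)$, there exist $\varepsilon$-embeddings $i'\colon X\to U$, $j'\colon Y\to V$ with $\|i'\restriction X_0-i\|<\varepsilon$,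 $\|j'\restriction Y_0-j\|<\varepsilon$ and $\|\Omega\circ i'-j'\circ T\|<\varepsilon$. Rational spaces and operators. A rational Banach space is a finite-dimensional Banach space $X$ together with a linear isomorphism $h\colon\mathbb R^n\to X$ such that $\|x\|=\max_{i<k}|f_i(x)|$ for finitely many linear functionals $f_0,\dots,f_{k-1}$ on $X$ with $f_i(h(\mathbb Q^n))\subseteq\mathbb Q$; the vectors in $h(\mathbb Q^n)$ are called rational. A linear operator between rational Banach spaces is rational if it has norm $\le1$ and maps rational vectors to rational vectors. A rational embedding is a rational operator that is isometric. Construction. Let $U,V$ be disjoint real vector spaces, each with a fixed countably infinite vector basis; rational vectors of $U$ (of $V$) are the rational linear combinations of the basis. A rational subspace of $U$ (of $V$) is a finite-dimensional subspace spanned by rational vectors, endowed with a norm that is rational with respect to the rational vectors it contains. Let $\mathcal F$ be the countable family of all triples $\langle T,e,k\rangle$, where $k$ is a natural number, $T\colon X\to Y$ is a rational operator between rational subspaces $X$ of $U$ and $Y$ of $V$, and $e=(i,j)$ is a pair of rational embeddings $i\colon X_0\to X$, $j\colon Y_0\to Y$ whose domains $X_0$, $Y_0$ are rational subspaces of $U$, $V$ respectively. Enumerate $\mathcal F$ as $\{\langle T_n,e_n,k_n\rangle\}_{n\in\omega}$, $e_n=(i_n,j_n)$, so that each triple occurs infinitely often. Define rational operators $F_n\colon U_n\to V_n$ between rational subspaces of $U$ and $V$ recursively. Put $U_0=0$, $V_0=0$, $F_0=0$. For $n>0$ consider the condition ($*$): $k:=k_n<n$, the domain of $i_n$ is $U_k$,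 the domain of $j_n$ is $V_k$ (with their norms), and $T_n\circ i_n=j_n\circ F_k$. If ($*$) fails, put $F_n=F_{n-1}$, $U_n=U_{n-1}$, $V_n=V_{n-1}$. If ($*$) holds, with $i_n\colon U_k\to X$, $j_n\colon V_k\to Y$, let $U_n$ be a rational subspace of $U$ containing $U_{n-1}$ isometrically (by a rational embedding) which, together with a rational embedding $i'\colon X\to U_n$, is a pushout (in the category of Banach spaces with operators of norm $\le 1$) of $i_n\colon U_k\to X$ and the inclusion $U_k\subseteq U_{n-1}$ (so $i'\circ i_n$ is the identity on $U_k$); similarly let $V_n\supseteq V_{n-1}$ with $j'\colon Y\to V_n$ be such a pushout of $j_n\colon V_k\to Y$ and $V_k\subseteq V_{n-1}$, realized as a rational subspace of $V$. Let $F_n\colon U_n\to V_n$ be the unique operator extending $F_{n-1}$ with $F_n\circ i'=j'\circ T_n$. (The pushout of $i\colon Z\to X$ and $f\colon Z\to Y$ is $(X\oplus_1 Y)/\{(i(z),-f(z)):z\in Z\}$ with the canonical maps.) Finally $U_\infty$, $V_\infty$ are the completions of $\bigcup_n U_n$, $\bigcup_n V_n$, and $F_\infty\colon U_\infty\to V_\infty$ is the unique continuous extension of $\bigcup_n F_n$. *)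

(* Defs.v *)
From HB Require Import structures.
From mathcomp Require Import all_boot all_order all_algebra.
From mathcomp Require Import all_classical all_reals all_analysis.
Set Implicit Arguments.
Unset Strict Implicit.
Unset Printing Implicit Defensive.
Import Order.TTheory GRing.Theory Num.Theory.
Import numFieldNormedType.Exports.
Local Open Scope classical_set_scope.
Local Open Scope ring_scope.

(* A linear subspace of E together with a norm on it.  The norm, and every
   operator defined on such a subspace, is represented by a function on the
   whole of E; its values outside of the carrier are meaningless. *)
Record normed_subspace (R : realType) (E : lmodType R) := NormedSubspace {
  carrier : set E;
  snorm : E -> R }.

Definition eq_subspace (R : realType) (E : lmodType R)
    (S S' : normed_subspace E) : Prop :=
  carrier S = carrier S' /\ {in carrier S, snorm S =1 snorm S'}.

Definition normed_in (R : realType) (X : normedModType R) (A : set X) :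
  normed_subspace X := NormedSubspace A (fun x => `|x|).

Definition whole (R : realType) (X : normedModType R) : normed_subspace X :=
  normed_in [set: X].

Definition is_subspace (R : realType) (E : lmodType R) (A : set E) : Prop :=
  GRing.submod_closed [in A].

Definition lin_span (R : realType) (E : lmodType R) (n : nat) (v : 'I_n -> E) :
  set E := [set x | exists c : 'I_n -> R, x = \sum_(i < n) c i *: v i].

Definition finite_dimensional (R : realType) (E : lmodType R) : Prop :=
  exists n (v : 'I_n -> E), lin_span v = [set: E].

Definition linear_on (R : realType) (E E' : lmodType R) (A : set E)
    (f : E -> E') : Prop :=
  forall a : R, {in A &, {morph f : x y / a *: x + y >-> a *: x + y}}.

Definition is_norm (R : realType) (E : lmodType R) (S : normed_subspace E) :
    Prop :=
  [/\ {in carrier S &, forall x y, snorm S (x + y) <= snorm S x + snorm S y},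
      {in carrier S, forall x (a : R), snorm S (a *: x) = `|a| * snorm S x} &
      {in carrier S, forall x, snorm S x = 0 -> x = 0}].

Definition opnorm (R : realType) (E E' : lmodType R) (S : normed_subspace E)
    (S' : normed_subspace E') (f : E -> E') : \bar R :=
  ereal_sup [set (snorm S' (f x))%:E |
             x in [set x | carrier S x /\ snorm S x <= 1]].

Definition nonexpansive (R : realType) (E E' : lmodType R)
    (S : normed_subspace E) (S' : normed_subspace E') (f : E -> E') : Prop :=
  [/\ f @` carrier S `<=` carrier S', linear_on (carrier S) f &
      (opnorm S S' f <= 1)%E].

Definition isometric_embedding (R : realType) (E E' : lmodType R)
    (S : normed_subspace E) (S' : normed_subspace E') (f : E -> E') : Prop :=
  [/\ f @` carrier S `<=` carrier S', linear_on (carrier S) f &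
      {in carrier S, forall x, snorm S' (f x) = snorm S x}].

Definition eps_embedding (R : realType) (X Y : normedModType R) (eps : R)
    (f : {linear X -> Y}) : Prop :=
  forall x, (1 + eps)^-1 * `|x| <= `|f x| /\ `|f x| <= `|x|.

Definition extension_problem (R : realType) (U V : completeNormedModType R)
    (Om : {linear U -> V}) (X Y : completeNormedModType R)
    (T : {linear X -> Y}) (X0 : set X) (Y0 : set Y)
    (i : X -> U) (j : Y -> V) : Prop :=
  [/\ finite_dimensional X /\ finite_dimensional Y,
      nonexpansive (whole X) (whole Y) T,
      [/\ is_subspace X0, is_subspace Y0 & T @` X0 `<=` Y0],
      isometric_embedding (normed_in X0) (whole U) i /\
      isometric_embedding (normed_in Y0) (whole V) j &
      {in X0, Om \o i =1 j \o T}].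

Definition condition_G (R : realType) (U V : completeNormedModType R)
    (Om : {linear U -> V}) : Prop :=
  forall (eps : R) (X Y : completeNormedModType R) (T : {linear X -> Y})
    (X0 : set X) (Y0 : set Y) (i : X -> U) (j : Y -> V),
  0 < eps -> extension_problem Om T X0 Y0 i j ->
  exists (i' : {linear X -> U}) (j' : {linear Y -> V}),
    [/\ eps_embedding eps i', eps_embedding eps j',
        (opnorm (normed_in X0) (whole U) (i' \- i)%R < eps%:E)%E,
        (opnorm (normed_in Y0) (whole V) (j' \- j)%R < eps%:E)%E &
        (opnorm (whole X) (whole V) ((Om \o i') \- (j' \o T))%R < eps%:E)%E].

Definition gurarii_property (R : realType) (U V : completeNormedModType R)
    (Om : {linear U -> V}) : Prop :=
  (opnorm (whole U) (whole V) Om <= 1)%E /\ condition_G Om.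

Definition condition_Gstar (R : realType) (U V : completeNormedModType R)
    (Om : {linear U -> V}) : Prop :=
  forall (eps : R) (X Y : completeNormedModType R) (T : {linear X -> Y})
    (X0 : set X) (Y0 : set Y) (i : X -> U) (j : Y -> V),
  0 < eps -> extension_problem Om T X0 Y0 i j ->
  exists (i' : {linear X -> U}) (j' : {linear Y -> V}),
    [/\ eps_embedding eps i', eps_embedding eps j',
        (opnorm (normed_in X0) (whole U) (i' \- i)%R < eps%:E)%E,
        (opnorm (normed_in Y0) (whole V) (j' \- j)%R < eps%:E)%E &
        Om \o i' =1 j' \o T].

Definition vector_basis (R : realType) (E : lmodType R) (b : nat -> E) : Prop :=
  (forall n (c : 'I_n -> R), \sum_(i < n) c i *: b i = 0 -> forall i, c i = 0)
  /\ (forall x, exists n (c : 'I_n -> R), x = \sum_(i < n) c i *: b i).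

Definition rational_vector (R : realType) (E : lmodType R) (b : nat -> E) :
  set E :=
  [set x | exists n (q : 'I_n -> rat), x = \sum_(i < n) ratr (q i) *: b i].

(* [R^o] is R seen as a vector space over itself: the f i are functionals. *)
Definition rational_norm (R : realType) (E : lmodType R) (b : nat -> E)
    (S : normed_subspace E) : Prop :=
  exists k (f : 'I_k -> E -> R^o),
    [/\ forall i, linear_on (carrier S) (f i),
        forall i x, carrier S x -> rational_vector b x ->
          (rational : set R) (f i x) &
        {in carrier S, forall x,
           snorm S x = \big[Order.max/0]_(i < k) `|f i x|}].

Definition rational_subspace (R : realType) (E : lmodType R) (b : nat -> E)
    (S : normed_subspace E) : Prop :=
  [/\ exists n (v : 'I_n -> E),
        (forall i, rational_vector b (v i)) /\ carrier S = lin_span v,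
      is_norm S & rational_norm b S].

Definition rational_operator (R : realType) (E E' : lmodType R)
    (b : nat -> E) (b' : nat -> E')
    (S : normed_subspace E) (S' : normed_subspace E') (f : E -> E') : Prop :=
  nonexpansive S S' f /\
  (forall x, carrier S x -> rational_vector b x -> rational_vector b' (f x)).

Definition rational_embedding (R : realType) (E E' : lmodType R)
    (b : nat -> E) (b' : nat -> E')
    (S : normed_subspace E) (S' : normed_subspace E') (f : E -> E') : Prop :=
  rational_operator b b' S S' f /\ isometric_embedding S S' f.

(* The span Z -i-> X, Z -f-> Y has the cocone X -p-> P <-q- Y. *)
Definition is_pushout (R : realType) (E : lmodType R)
    (Z X Y P : normed_subspace E) (i f p q : E -> E) : Prop :=
  [/\ nonexpansive X P p, nonexpansive Y P q,
      {in carrier Z, p \o i =1 q \o f} &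
      forall (W : completeNormedModType R) (g h : E -> W),
        nonexpansive X (whole W) g -> nonexpansive Y (whole W) h ->
        {in carrier Z, g \o i =1 h \o f} ->
        exists m : E -> W,
          [/\ nonexpansive P (whole W) m,
              {in carrier X, m \o p =1 g}, {in carrier Y, m \o q =1 h} &
              forall m' : E -> W, nonexpansive P (whole W) m' ->
                {in carrier X, m' \o p =1 g} ->
                {in carrier Y, m' \o q =1 h} ->
                {in carrier P, m' =1 m}]].

(* The operator tT : tX -> tY, the pair of embeddings ti : tX0 -> tX,
   tj : tY0 -> tY, and the number tk. *)
Record triple (R : realType) (U V : lmodType R) := Triple {
  tX : normed_subspace U;
  tY : normed_subspace V;
  tT : U -> V;
  tX0 : normed_subspace U;
  tY0 : normed_subspace V;
  ti : U -> U;
  tj : V -> V;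
  tk : nat }.

Definition eq_triple (R : realType) (U V : lmodType R) (t t' : triple U V) :
    Prop :=
  [/\ eq_subspace (tX t) (tX t') /\ eq_subspace (tY t) (tY t'),
      {in carrier (tX t), tT t =1 tT t'},
      eq_subspace (tX0 t) (tX0 t') /\ eq_subspace (tY0 t) (tY0 t'),
      {in carrier (tX0 t), ti t =1 ti t'} /\
      {in carrier (tY0 t), tj t =1 tj t'} &
      tk t = tk t'].

Definition triple_family (R : realType) (U V : lmodType R)
    (bU : nat -> U) (bV : nat -> V) : set (triple U V) :=
  [set t | [/\ rational_subspace bU (tX t) /\ rational_subspace bV (tY t),
               rational_operator bU bV (tX t) (tY t) (tT t),
               rational_subspace bU (tX0 t) /\ rational_subspace bV (tY0 t),
               rational_embedding bU bU (tX0 t) (tX t) (ti t) &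
               rational_embedding bV bV (tY0 t) (tY t) (tj t)]].

Definition repeating_enumeration (R : realType) (U V : lmodType R)
    (bU : nat -> U) (bV : nat -> V) (tr : nat -> triple U V) : Prop :=
  (forall n, triple_family bU bV (tr n)) /\
  (forall t, triple_family bU bV t ->
     infinite_set [set n | eq_triple (tr n) t]).

Definition condition_star (R : realType) (U V : lmodType R)
    (tr : nat -> triple U V) (Us : nat -> normed_subspace U)
    (Vs : nat -> normed_subspace V) (F : nat -> U -> V) (n : nat) : Prop :=
  let t := tr n in let k := tk t in
  [/\ (k < n)%N, eq_subspace (tX0 t) (Us k), eq_subspace (tY0 t) (Vs k) &
      {in carrier (Us k), tT t \o ti t =1 tj t \o F k}].

Definition pushout_step (R : realType) (U V : lmodType R)
    (bU : nat -> U) (bV : nat -> V)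
    (tr : nat -> triple U V) (Us : nat -> normed_subspace U)
    (Vs : nat -> normed_subspace V) (F : nat -> U -> V) (n : nat) : Prop :=
  let t := tr n in let k := tk t in
  [/\ rational_embedding bU bU (Us n.-1) (Us n) id,
      rational_embedding bV bV (Vs n.-1) (Vs n) id,
      {in carrier (Us n.-1), F n =1 F n.-1} &
      exists (i' : U -> U) (j' : V -> V),
        [/\ rational_embedding bU bU (tX t) (Us n) i',
            is_pushout (Us k) (tX t) (Us n.-1) (Us n) (ti t) id i' id,
            rational_embedding bV bV (tY t) (Vs n) j',
            is_pushout (Vs k) (tY t) (Vs n.-1) (Vs n) (tj t) id j' id &
            {in carrier (tX t), F n \o i' =1 j' \o tT t}]].

Definition idle_step (R : realType) (U V : lmodType R)
    (Us : nat -> normed_subspace U) (Vs : nat -> normed_subspace V)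
    (F : nat -> U -> V) (n : nat) : Prop :=
  [/\ eq_subspace (Us n) (Us n.-1), eq_subspace (Vs n) (Vs n.-1) &
      {in carrier (Us n), F n =1 F n.-1}].

(* A run of the recursion: the choices of the spaces realizing the pushouts
   are left open.  The map F 0 is 0 on [set 0], being linear there. *)
Definition generic_sequence (R : realType) (U V : lmodType R)
    (bU : nat -> U) (bV : nat -> V) (tr : nat -> triple U V)
    (Us : nat -> normed_subspace U) (Vs : nat -> normed_subspace V)
    (F : nat -> U -> V) : Prop :=
  [/\ forall n, [/\ rational_subspace bU (Us n), rational_subspace bV (Vs n) &
                    rational_operator bU bV (Us n) (Vs n) (F n)],
      carrier (Us 0%N) = [set 0] /\ carrier (Vs 0%N) = [set 0],
      forall n, (0 < n)%N -> condition_star tr Us Vs F n ->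
        pushout_step bU bV tr Us Vs F n &
      forall n, (0 < n)%N -> ~ condition_star tr Us Vs F n ->
        idle_step Us Vs F n].

(* W, with the isometric map iota, is the completion of the union of the
   increasing chain of normed spaces S n. *)
Definition is_completion (R : realType) (E : lmodType R)
    (S : nat -> normed_subspace E) (W : completeNormedModType R)
    (iota : E -> W) : Prop :=
  (forall n, isometric_embedding (S n) (whole W) iota) /\
  dense (iota @` \bigcup_n carrier (S n)).

(* Main.v *)
Require Import Defs.
From HB Require Import structures.
From mathcomp Require Import all_boot all_order all_algebra.
From mathcomp Require Import all_classical all_reals all_analysis.
From mathcomp Require Import ring lra zify.
Set Implicit Arguments.
Unset Strict Implicit.
Unset Printing Implicit Defensive.
Import Order.TTheory GRing.Theory Num.Theory.
Import numFieldNormedType.Exports.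
Local Open Scope classical_set_scope.
Local Open Scope ring_scope.

(* Given an extension problem, equip X + U_n with the pushout norm of
   X <- X0 -> U_infty, pulled back along U_n -> U_infty, plus a small multiple of
   the norm of X; do the same with Y + V_n.  These norms are almost isometric on
   X and extend the norm of U_n.  For n large every x in X0 is close in the sum
   to the vectors of U_n that approximate i(x).  The operator T + F_n is
   nonexpansive because F_infty is.  Choosing bases of X and Y in which T is a
   partial identity, X + U_n becomes a rational subspace of U and T + F_n
   preserves rational vectors.

   The norms are then replaced by close rational ones.  One takes the largest
   norm that does not exceed a coarse rational norm and is at most 1 on a finite
   rational net of the unit ball.  Passing from a norm p to the largest norm
   below p that is at most 1 at w means z |-> inf_t |t| + p(z - t w), so the
   norm stays a maximum of finitely many rational functionals by
   Fourier-Motzkin elimination.  If the net in Y + V_n contains the image of the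
   net in X + U_n, the operator stays nonexpansive.

   The resulting triple occurs in the enumeration at some stage m > n, and the
   embeddings of the m-th step restrict to X and Y.  After a common rescaling
   they solve the problem, and they intertwine T and F_infty exactly. *)

(** * Rational numbers, seminorms and Fourier-Motzkin elimination *)

Section Rational.
Variable R : realType.
Implicit Types a c x y : R.

Lemma rational0 : rational (0 : R).
Proof. by exists 0; rewrite ?rmorph0. Qed.
Lemma rational1 : rational (1 : R).
Proof. by exists 1; rewrite ?rmorph1. Qed.
Lemma rationalN x : rational x -> rational (- x).
Proof. by move=> [q _ <-]; exists (- q); rewrite ?rmorphN. Qed.
Lemma rationalD x y : rational x -> rational y -> rational (x + y).
Proof. by move=> [q _ <-] [r _ <-]; exists (q + r); rewrite ?rmorphD. Qed.
Lemma rationalB x y : rational x -> rational y -> rational (x - y).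
Proof. by move=> xr yr; apply: rationalD => //; exact: rationalN. Qed.
Lemma rationalM x y : rational x -> rational y -> rational (x * y).
Proof. by move=> [q _ <-] [r _ <-]; exists (q * r); rewrite ?rmorphM. Qed.
Lemma rationalV x : rational x -> rational x^-1.
Proof. by move=> [q _ <-]; exists q^-1; rewrite ?fmorphV. Qed.

Lemma rational_sign (s : bool) : rational ((-1) ^+ s : R).
Proof. by case: s; rewrite ?expr1 ?expr0; [apply: rationalN|]; exact: rational1. Qed.

Lemma rational_nat n : rational (n%:R : R).
Proof. by exists n%:R; rewrite ?ratr_nat. Qed.

End Rational.

(** A row with [0 < be k] bounds t above by [(M - al k) / be k], the other rows bound t below or do
    not involve it. The least upper bound works: the hypothesis on a pair says that the convex
    combination of two rows in which t cancels is at most M, which rearranges to the row j at this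
    t. *)
Lemma fourier_motzkin (R : realType) (J : finType) (al be : J -> R) (M : R) :
    (exists k, 0 < be k) ->
    (forall j k, be j <= 0 -> 0 < be k ->
       (al j * be k - al k * be j) / (be k - be j) <= M) ->
  exists t, forall j, al j + t * be j <= M.
Proof.
move=> [k0 k0P] hM.
pose t := fun k => (M - al k) / be k.
have [k kP tmin] := @Order.TotalTheory.arg_minP _ _ J k0 (fun k => 0 < be k) t k0P.
exists (t k) => j; have [bj|bj] := ltP 0 (be j).
  have := tmin j bj; rewrite /t => h.
  have : (M - al k) / be k * be j <= M - al j by rewrite -ler_pdivlMr.
  lra.
have := hM j k bj kP; rewrite ler_pdivrMr; last by lra.
rewrite /t => h.
rewrite -(ler_pM2r kP) mulrDl mulrAC divfK ?gt_eqF//.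
nra.
Qed.

Section LinearOn.
Context {R : realType} {E E' : lmodType R}.

(** The propositional form of [is_subspace], free of boolean membership. *)
Definition lin_closed (A : set E) :=
  A 0 /\ forall (a : R) x y, A x -> A y -> A (a *: x + y).

Variables (A : set E) (f : E -> E').
Hypothesis clA : lin_closed A.

Lemma lin_closedZ (a : R) x : A x -> A (a *: x).
Proof. by move=> Ax; rewrite -[_ *: _]addr0; apply: (clA.2) => //; exact: clA.1. Qed.

Lemma lin_closedD x y : A x -> A y -> A (x + y).
Proof. by move=> Ax Ay; rewrite -[x]scale1r; exact: clA.2. Qed.

Lemma lin_closedN x : A x -> A (- x).
Proof. by move=> Ax; rewrite -scaleN1r; exact: lin_closedZ. Qed.

Lemma lin_closedB x y : A x -> A y -> A (x - y).
Proof. by move=> Ax Ay; apply: lin_closedD => //; exact: lin_closedN. Qed.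

Lemma lin_closed_sum (I : finType) (F : I -> E) :
  (forall i, A (F i)) -> A (\sum_i F i).
Proof.
by move=> AF; elim/big_ind : _ => //; [exact: clA.1|exact: lin_closedD].
Qed.

Hypothesis linf : linear_on A f.

Lemma linear_onP (a : R) x y : A x -> A y -> f (a *: x + y) = a *: f x + f y.
Proof. by move=> Ax Ay; apply: linf; exact: mem_set. Qed.

Lemma linear_onD x y : A x -> A y -> f (x + y) = f x + f y.
Proof. by move=> Ax Ay; have := linear_onP 1 Ax Ay; rewrite !scale1r. Qed.

Lemma linear_on0 : f 0 = 0.
Proof.
have /(_ 1) h := fun a => linear_onP a clA.1 clA.1.
by move: h; rewrite !scale1r addr0 -{1}[f 0]addr0 => /addrI.
Qed.

Lemma linear_onZ (a : R) x : A x -> f (a *: x) = a *: f x.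
Proof.
by move=> Ax; have := linear_onP a Ax clA.1; rewrite linear_on0 !addr0.
Qed.

Lemma linear_onN x : A x -> f (- x) = - f x.
Proof. by move=> Ax; rewrite -scaleN1r linear_onZ// scaleN1r. Qed.

Lemma linear_onB x y : A x -> A y -> f (x - y) = f x - f y.
Proof. by move=> Ax Ay; rewrite linear_onD ?linear_onN//; exact: lin_closedN. Qed.

Lemma linear_on_sum (I : finType) (F : I -> E) :
  (forall i, A (F i)) -> f (\sum_i F i) = \sum_i f (F i).
Proof.
move=> AF.
suff [] : A (\sum_i F i) /\ f (\sum_i F i) = \sum_i f (F i) by [].
elim/big_ind2 : _ => //; first by split; [exact: clA.1|exact: linear_on0].
by move=> x1 x2 y1 y2 [A1 <-] [A2 <-]; split; [exact: lin_closedD|rewrite linear_onD].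
Qed.

End LinearOn.

Section Seminorm.
Context {R : realType} {E : lmodType R}.
Implicit Types (A : set E) (p r : E -> R).

Definition seminorm_on A p :=
  (forall x y, A x -> A y -> p (x + y) <= p x + p y) /\
  (forall (a : R) x, A x -> p (a *: x) = `|a| * p x).

Lemma seminorm_on0 A p : lin_closed A -> seminorm_on A p -> p 0 = 0.
Proof. by move=> [A0 _] [_ /(_ 0 0 A0)]; rewrite scale0r normr0 mul0r. Qed.

Lemma seminorm_onN A p x : seminorm_on A p -> A x -> p (- x) = p x.
Proof. by move=> [_ pZ] Ax; rewrite -scaleN1r pZ// normrN1 mul1r. Qed.

Lemma seminorm_on_ge0 A p x : lin_closed A -> seminorm_on A p -> A x -> 0 <= p x.
Proof.
move=> clA ps Ax; have := ps.1 _ _ Ax (lin_closedN clA Ax).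
by rewrite subrr (seminorm_on0 clA ps) (seminorm_onN ps)//; lra.
Qed.

Lemma seminorm_on_sum A p (I : finType) (F : I -> E) :
    lin_closed A -> seminorm_on A p -> (forall i, A (F i)) ->
  p (\sum_i F i) <= \sum_i p (F i).
Proof.
move=> clA ps AF.
suff [] : A (\sum_i F i) /\ p (\sum_i F i) <= \sum_i p (F i) by [].
elim/big_ind2 : _ => //; first by split; [exact: clA.1|rewrite (seminorm_on0 clA ps)].
move=> x1 x2 y1 y2 [A1 h1] [A2 h2]; split; first exact: (lin_closedD clA).
by rewrite (le_trans (ps.1 _ _ A1 A2))// lerD.
Qed.

Lemma is_normP (S : normed_subspace E) :
  is_norm S <-> seminorm_on (carrier S) (snorm S) /\
               (forall x, carrier S x -> snorm S x = 0 -> x = 0).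
Proof.
split=> [[h1 h2 h3]|[[h1 h2] h3]].
  split; last by move=> x Ax; apply: h3; exact: mem_set.
  split; first by move=> x y Ax Ay; apply: h1; exact: mem_set.
  by move=> a x Ax; apply: h2; exact: mem_set.
split.
- by move=> x y; rewrite !inE; exact: h1.
- by move=> x; rewrite inE => Ax a; exact: h2.
- by move=> x; rewrite inE; exact: h3.
Qed.

End Seminorm.

(** The maximum starts at 0, so the value 0 is allowed separately; this covers an empty index
    type. *)
Lemma eq_bigmax_norm (R : realType) (J : finType) (F : J -> R) (m : R) :
    (forall j, F j <= m) -> 0 <= m -> (m = 0 \/ exists j, m <= F j) ->
  m = \big[Order.max/0]_j F j.
Proof.
move=> Fm m0 h; apply/eqP; rewrite eq_le; apply/andP; split; last first.
  by apply: bigmax_le.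
by case: h => [->|[j mj]]; [exact: bigmax_ge_id|exact: bigmax_sup mj].
Qed.

Lemma bigmax_norm_attained (R : realType) (J : finType) (F : J -> R) :
  \big[Order.max/0]_j F j = 0 \/ exists j, \big[Order.max/0]_j F j = F j.
Proof.
elim/big_ind : _ => [|x y hx hy|j _]; [by left| |by right; exists j].
by rewrite maxEle; case: ifP.
Qed.

Lemma bigmax_scale (R : realType) (J : finType) (F : J -> R) (a : R) : 0 <= a ->
  \big[Order.max/0]_j (a * F j) = a * \big[Order.max/0]_j F j.
Proof.
by move=> a0; rewrite (big_morph ( *%R a) (fun y z => maxr_pMr y z a0) (mulr0 _)).
Qed.

Section RationalNorm.
Context {R : realType} {E : lmodType R}.
Variable b : nat -> E.
Implicit Types S : normed_subspace E.

(** The functionals built below are indexed by products and options, so an arbitrary finite index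
    type is convenient. *)
Lemma rational_norm_fin S (J : finType) (f : J -> E -> R^o) :
    (forall j, linear_on (carrier S) (f j)) ->
    (forall j x, carrier S x -> rational_vector b x -> (rational : set R) (f j x)) ->
    (forall x, carrier S x -> snorm S x = \big[Order.max/0]_j `|f j x|) ->
  rational_norm b S.
Proof.
move=> f1 f2 f3; exists #|J|, (fun i => f (enum_val i)); split.
- by move=> i; exact: f1.
- by move=> i x; exact: f2.
- move=> x; rewrite inE => Ax; rewrite f3// (reindex (@enum_val J predT))//=.
  exact/onW_bij/enum_val_bij.
Qed.

End RationalNorm.

(** * Adding a point to the unit ball of a rational norm *)

Section Adjoin.
Context {R : realType} {E : lmodType R}.
Variable b : nat -> E.
Implicit Types S : normed_subspace E.

Lemma lin_closed_span n (v : 'I_n -> E) : lin_closed (lin_span v).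
Proof.
split; first by exists (fun=> 0); rewrite big1// => i _; rewrite scale0r.
move=> a _ _ [c ->] [d ->]; exists (fun i => a * c i + d i).
rewrite scaler_sumr -big_split/=; apply: eq_bigr => i _.
by rewrite scalerDl scalerA.
Qed.

Lemma rational_subspace_closed S : rational_subspace b S -> lin_closed (carrier S).
Proof. by move=> [[n [v [_ ->]]] _ _]; exact: lin_closed_span. Qed.

(* The new norm is the largest one below the old norm that is at most 1 at w,
   namely [inf_t |t| + snorm S (z - t w)]. *)
Lemma adjoin_generator S w :
    rational_subspace b S -> carrier S w -> rational_vector b w ->
  exists S', [/\ carrier S' = carrier S, rational_subspace b S',
    forall x, carrier S x -> snorm S' x <= snorm S x, snorm S' w <= 1 &
    forall r, seminorm_on (carrier S) r ->
      (forall x, carrier S x -> r x <= snorm S x) -> r w <= 1 ->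
      forall x, carrier S x -> r x <= snorm S' x].
Proof.
move=> Srat Sw ratw; have clS := rational_subspace_closed Srat.
have [Sspan /is_normP[Ssemi Sdef] [k [f [f1 f2 f3]]]] := Srat.
(* The extra zero functional [None] makes the maximum attained even when it equals the default 0,
   and it supplies a row with a positive coefficient of t for the elimination. *)
pose g (o : option 'I_k) : E -> R^o := if o is Some i then f i else fun=> 0.
have lg o : linear_on (carrier S) (g o).
  by case: o => [i|] //= a x y _ _; rewrite scaler0 addr0.
have ratg o x : carrier S x -> rational_vector b x -> (rational : set R) (g o x).
  by case: o => [i|] Sx rx /=; [exact: f2|exact: rational0].
(* For fixed z, the function [|t| + snorm S (z - t *: w)] of t is the maximum of the affine
   functions [al j z + t * be j]; the two booleans are the signs chosen for the functional and for
   t. *)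
pose al (j : option 'I_k * bool * bool) (z : E) : R := (-1) ^+ j.1.2 * g j.1.1 z.
pose be (j : option 'I_k * bool * bool) : R := (-1) ^+ j.2 - (-1) ^+ j.1.2 * g j.1.1 w.
have subE t z : carrier S z -> carrier S (z - t *: w).
  by move=> Sz; apply: (lin_closedB clS) => //; exact: (lin_closedZ clS).
have gE o t z : carrier S z -> g o (z - t *: w) = g o z - t * g o w.
  move=> Sz; rewrite (linear_onB clS (lg o))//; last exact: (lin_closedZ clS).
  by rewrite (linear_onZ clS (lg o)).
have albeE j t z : carrier S z ->
    al j z + t * be j = (-1) ^+ j.2 * t + (-1) ^+ j.1.2 * g j.1.1 (z - t *: w).
  by move=> Sz; rewrite gE// /al /be; ring.
have gle o z : carrier S z -> `|g o z| <= snorm S z.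
  move=> Sz; case: o => [i|] /=; last by rewrite normr0 (seminorm_on_ge0 clS Ssemi).
  by rewrite f3 ?inE//; exact: (le_bigmax _ (fun i => `|f i z|)).
have sgn_le (s : bool) (y : R) : (-1) ^+ s * y <= `|y|.
  by rewrite (le_trans (ler_norm _))// normrM normrX normrN1 expr1n mul1r.
have sgn_norm (y : R) : exists s : bool, (-1) ^+ s * y = `|y|.
  by exists (y < 0); rewrite -normrEsign.
have alble j t z : carrier S z -> al j z + t * be j <= `|t| + snorm S (z - t *: w).
  move=> Sz; rewrite albeE//; apply: lerD => //.
  by rewrite (le_trans (sgn_le _ _))// gle//; exact: subE.
have alble_max t z M : carrier S z -> (forall j, al j z + t * be j <= M) ->
    `|t| + snorm S (z - t *: w) <= M.
  move=> Sz hM; have [s st] := sgn_norm t.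
  suff: exists o, snorm S (z - t *: w) = `|g o (z - t *: w)|.
    move=> [oi goi]; have [s' s'o] := sgn_norm (g oi (z - t *: w)).
    by have := hM (oi, s', s); rewrite albeE//= st s'o goi.
  rewrite f3 ?inE; last exact: subE.
  have [->|[i ->]] := bigmax_norm_attained (fun i => `|f i (z - t *: w)| : R).
    by exists None; rewrite normr0.
  by exists (Some i).
(* The combination of two rows from which t has been eliminated. Pairs of the wrong signs get the
   zero functional, which does not affect a maximum of absolute values. *)
pose h (jk : (option 'I_k * bool * bool) * (option 'I_k * bool * bool)) (z : E) : R^o :=
  if (be jk.1 <= 0) && (0 < be jk.2) then
    (al jk.1 z * be jk.2 - al jk.2 z * be jk.1) / (be jk.2 - be jk.1) else 0.
have al_lin j a x y : carrier S x -> carrier S y -> al j (a *: x + y) = a * al j x + al j y.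
  move=> Sx Sy; rewrite /al (linear_onP (lg _))//.
  by rewrite -[a *: g j.1.1 x]/(a * g j.1.1 x); ring.
have h_lin jk : linear_on (carrier S) (h jk).
  move=> a x y; rewrite !inE => Sx Sy; rewrite /h; case: ifP => _.
    by rewrite !al_lin//; rewrite -[RHS]/(a * _ + _); ring.
  by rewrite scaler0 addr0.
have h_up jk t z : carrier S z -> h jk z <= `|t| + snorm S (z - t *: w).
  move=> Sz; rewrite /h; case: ifPn => [/andP[bj bk]|_]; last first.
    by rewrite addr_ge0// (seminorm_on_ge0 clS Ssemi)//; exact: subE.
  rewrite ler_pdivrMr; last by lra.
  have := alble jk.1 t z Sz; have := alble jk.2 t z Sz.
  move: (_ + snorm _ _) (al _ _) (al _ _) (be _) (be _) bj bk => M a1 a2 b1 b2; nra.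
(* The lower bound is the upper bound at [- t] and [- z]. *)
have h_norm_up jk t z : carrier S z -> `|h jk z| <= `|t| + snorm S (z - t *: w).
  move=> Sz; rewrite ler_norml h_up// andbT lerNl.
  rewrite -[- h _ _](linear_onN clS (h_lin jk))//.
  have := h_up jk (- t) (- z) (lin_closedN clS Sz).
  by rewrite normrN scaleNr -opprD (seminorm_onN Ssemi)//; exact: subE.
pose p' z := \big[Order.max/0]_jk `|h jk z|.
have p'_up t z : carrier S z -> p' z <= `|t| + snorm S (z - t *: w).
  move=> Sz; apply: bigmax_le => [|jk _]; last exact: h_norm_up.
  by rewrite addr_ge0// (seminorm_on_ge0 clS Ssemi)//; exact: subE.
(* Elimination with M equal to [p' z] shows that the infimum over t is attained and equals [p']. *)
have p'_low z : carrier S z -> exists t, `|t| + snorm S (z - t *: w) <= p' z.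
  move=> Sz.
  have [||t ht] := @fourier_motzkin R _ (al^~ z) be (p' z).
  - by exists (None, false, false); rewrite /be/= mulr0 subr0.
  - move=> j l bj bl; apply: (@le_trans _ _ (h (j, l) z)).
      by rewrite /h/= bj bl.
    by rewrite (le_trans (ler_norm _))//; exact: (le_bigmax _ (fun jk => `|h jk z|) (j, l)).
  - by exists t; exact: alble_max.
have p'_max r : seminorm_on (carrier S) r ->
    (forall x, carrier S x -> r x <= snorm S x) -> r w <= 1 ->
    forall x, carrier S x -> r x <= p' x.
  move=> rs rle rw x Sx; have [t] := p'_low x Sx; apply: le_trans.
  rewrite -{1}(subrK (t *: w) x) addrC.
  have Stw := lin_closedZ clS t Sw.
  rewrite (le_trans (rs.1 _ _ Stw (subE _ _ Sx)))// lerD//.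
    by rewrite rs.2// ler_piMr.
  by apply: rle; exact: subE.
exists (NormedSubspace (carrier S) p'); split => //=.
- split => //.
  + apply/is_normP; split => /=.
      split=> [x y Sx Sy|a x Sx].
        apply: bigmax_le => [|jk _]; first by rewrite addr_ge0// bigmax_ge_id.
        rewrite (linear_onD (h_lin jk))// (le_trans (ler_normD _ _))//.
        by apply: lerD; [exact: (le_bigmax _ (fun jk => `|h jk x|))|
                         exact: (le_bigmax _ (fun jk => `|h jk y|))].
      rewrite /p' -bigmax_scale ?normr_ge0//; apply: eq_bigr => jk _.
      by rewrite (linear_onZ clS (h_lin jk))// normrM.
    (* A value 0 forces t = 0 in the attained infimum, and then the old norm of x vanishes. *)
    move=> x Sx px0; have [t] := p'_low x Sx; rewrite px0.
    have St := subE t x Sx; have := seminorm_on_ge0 clS Ssemi St.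
    have := normr_ge0 t => t0 s0 ts.
    have t00 : `|t| = 0 by lra.
    move/eqP: t00; rewrite normr_eq0 => /eqP t00; move: St s0 ts; rewrite t00 scale0r subr0.
    by move=> _ s0; rewrite normr0 add0r => s1; apply: Sdef => //; apply/eqP; rewrite eq_le s1.
  + apply: (@rational_norm_fin _ _ b _ _ h) => //= jk x Sx ratx.
    have ratal j z : carrier S z -> rational_vector b z -> rational (al j z).
      by move=> Sz rz; apply: rationalM; [exact: rational_sign|exact: ratg].
    have ratbe j : rational (be j).
      apply: rationalB; first exact: rational_sign.
      by apply: rationalM; [exact: rational_sign|exact: ratg].
    rewrite /h; case: ifP => _; last exact: rational0.
    apply: rationalM; last by apply/rationalV/rationalB.
    by apply: rationalB; apply: rationalM => //; exact: ratal.
- by move=> x Sx; have := p'_up 0 x Sx; rewrite normr0 add0r scale0r subr0.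
- have := p'_up 1 w Sw; rewrite scale1r subrr (seminorm_on0 clS Ssemi).
  by rewrite normr1 addr0.
Qed.

(** Maximality survives iteration: a seminorm below the old norm and at most 1 on all the points
    lies below each intermediate norm in turn. *)
Lemma adjoin_generators S (ws : seq E) :
    rational_subspace b S ->
    (forall w, w \in ws -> carrier S w /\ rational_vector b w) ->
  exists S', [/\ carrier S' = carrier S, rational_subspace b S',
    forall x, carrier S x -> snorm S' x <= snorm S x,
    forall w, w \in ws -> snorm S' w <= 1 &
    forall r, seminorm_on (carrier S) r ->
      (forall x, carrier S x -> r x <= snorm S x) ->
      (forall w, w \in ws -> r w <= 1) ->
      forall x, carrier S x -> r x <= snorm S' x].
Proof.
move=> Srat; elim: ws => [_|w ws IH Hws]; first by exists S; split => // r _ h _; exact: h.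
have [|S1 [c1 r1 le1 w1 m1]] := IH.
  by move=> w' hw'; apply: Hws; rewrite inE hw' orbT.
have [Sw ratw] := Hws w (mem_head _ _).
have [|S2 [c2 r2 le2 w2 m2]] := adjoin_generator r1 _ ratw; first by rewrite c1.
rewrite c1 in c2 le2 m2; exists S2; split => //.
- by move=> x Sx; rewrite (le_trans (le2 _ Sx))// le1.
- move=> w'; rewrite inE => /orP[/eqP->//|hw']; rewrite (le_trans (le2 _ _)) ?w1//.
  by have [] := Hws w'; first by rewrite inE hw' orbT.
- move=> r rs rle rws; apply: m2 => //; last by apply: rws; exact: mem_head.
  by apply: m1 => // w' hw'; apply: rws; rewrite inE hw' orbT.
Qed.

End Adjoin.

(** Packages a function with a proof of linearity as an element of the bundled type. *)
Lemma exists_linear (R : realType) (E E' : lmodType R) (f : E -> E') :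
  linear f -> exists g : {linear E -> E'}, g =1 f.
Proof.
move=> lf; pose L := GRing.isLinear.Build R E E' _ f lf.
by exists (HB.pack_for {linear E -> E'} f L).
Qed.

(** * Coordinates and norms on R^d *)

Section Coordinates.
Context {R : realType} {E : lmodType R}.
Variable b : nat -> E.
Hypothesis hb : vector_basis b.

Lemma basis_coordinates : exists co : nat -> {linear E -> R^o},
  (forall x, exists n, (forall k, (n <= k)%N -> co k x = 0) /\
     x = \sum_(i < n) (co i x : R) *: b i) /\
  (forall k l, co k (b l) = (k == l)%:R).
Proof.
have [hfree hspan] := hb.
(* Coefficients padded with zeros to a full sequence, so that representations of different lengths
   can be added and compared. *)
pose rep x (d : nat -> R) :=
  exists m, (forall k, (m <= k)%N -> d k = 0) /\ x = \sum_(i < m) d i *: b i.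
have widen (d : nat -> R) m M : (forall k, (m <= k)%N -> d k = 0) -> (m <= M)%N ->
    \sum_(i < m) d i *: b i = \sum_(i < M) d i *: b i.
  move=> d0 mM; rewrite (big_ord_widen _ (fun i => d i *: b i) mM) [RHS](bigID (fun i : 'I_M => (i < m)%N))/=.
  by rewrite [X in _ + X]big1 ?addr0// => i; rewrite -leqNgt => /d0 ->; rewrite scale0r.
have repP x y (a : R) d e : rep x d -> rep y e -> rep (a *: x + y) (fun k => a * d k + e k).
  move=> [m [d0 ->]] [n [e0 ->]]; exists (maxn m n); split=> [k|].
    by rewrite geq_max => /andP[mk nk]; rewrite d0// e0// mulr0 addr0.
  rewrite (widen d m (maxn m n)) ?leq_maxl// (widen e n (maxn m n)) ?leq_maxr//.
  rewrite scaler_sumr -big_split/=; apply: eq_bigr => i _.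
  by rewrite scalerDl scalerA.
have rep_uniq x d e : rep x d -> rep x e -> forall k, d k = e k.
  move=> xd xe k; have [m [h0 hs]] := repP _ _ (-1) _ _ xd xe.
  move: hs; rewrite scaleN1r addNr => /esym hs.
  have [km|mk] := ltnP k m.
    have := hfree m (fun i => -1 * d i + e i) hs (Ordinal km) => /=; lra.
  by have := h0 k mk; lra.
have ex x : exists d, rep x d.
  have [n [c ->]] := hspan x.
  pose d k := if insub k is Some i then c i else 0.
  exists d, n; split=> [k nk|].
    by rewrite /d insubF// ltnNge nk.
  by apply: eq_bigr => i _; rewrite /d valK.
have [c cP] := choice ex.
have lin k : linear (fun x => c x k : R^o).
  by move=> a x y; rewrite (rep_uniq _ _ _ (cP (a *: x + y)) (repP _ _ a _ _ (cP x) (cP y))).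
have [co coE] := choice (fun k => exists_linear (lin k)).
exists co; split.
  move=> x; have [n [d0 xE]] := cP x; exists n; split=> [k nk|].
    by rewrite coE d0.
  by rewrite {1}xE; apply: eq_bigr => i _; rewrite coE.
move=> k l; rewrite coE.
apply: (rep_uniq (b l) _ (fun k => (k == l)%:R)); first exact: cP.
exists l.+1; split=> [k' lk|]; first by rewrite gtn_eqF.
by rewrite big_ord_recr/= big1 ?eqxx ?scale1r ?add0r// => i _; rewrite ltn_eqF ?scale0r.
Qed.

(** Testing rationality coordinatewise reduces closure properties of rational vectors to those of
    rational numbers. *)
Lemma rational_vectorP (co : nat -> {linear E -> R^o}) :
  (forall x, exists n, (forall k, (n <= k)%N -> co k x = 0) /\
     x = \sum_(i < n) (co i x : R) *: b i) ->
  (forall k l, co k (b l) = (k == l)%:R) ->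
  forall x, rational_vector b x <-> forall k, (rational : set R) (co k x).
Proof.
move=> coS cob x; split=> [[n [q ->]] k|h].
  rewrite linear_sum/=; elim/big_ind : _ => //.
  - exact: rational0.
  - exact: rationalD.
  - move=> i _; rewrite linearZ/= cob; apply: rationalM; first by exists (q i).
    exact: rational_nat.
have [n [_ xE]] := coS x.
have /choice[q qE] : forall k, exists q : rat, ratr q = co k x :> R.
  by move=> k; have [q _ qE] := h k; exists q.
by exists n, q; rewrite {1}xE; apply: eq_bigr => i _; rewrite qE.
Qed.

Lemma rational_basis_vector k : rational_vector b (b k).
Proof.
exists k.+1, (fun i => (i == k :> nat)%:R).
rewrite big_ord_recr/= big1 ?eqxx ?rmorph1 ?scale1r ?add0r// => i _.
by rewrite ltn_eqF// rmorph0 scale0r.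
Qed.

Lemma rational_vector_comb (n : nat) (c : 'I_n -> R) (v : 'I_n -> E) :
  (forall i, rational (c i)) -> (forall i, rational_vector b (v i)) ->
  rational_vector b (\sum_i c i *: v i).
Proof.
have [co [coS cob]] := basis_coordinates.
have rvP := rational_vectorP coS cob.
move=> cr vr; apply/rvP => k.
rewrite linear_sum; elim/big_ind : _ => //.
- exact: rational0.
- exact: rationalD.
- by move=> i _; rewrite linearZ; apply: rationalM => //; exact: (rvP _).1.
Qed.

End Coordinates.

(** Coefficients are taken as a row vector, so that matrix algebra and the max norm on rows apply to
    them. *)
Definition comb (R : realType) (E : lmodType R) n (g : 'I_n -> E) (v : 'rV[R]_n) : E :=
  \sum_i v 0 i *: g i.

Definition free_family (R : realType) (E : lmodType R) n (g : 'I_n -> E) :=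
  forall v, comb g v = 0 -> v = 0.

Section Comb.
Context {R : realType} {E : lmodType R}.

Lemma comb_linear n (g : 'I_n -> E) : linear (comb g).
Proof.
move=> a v w; rewrite /comb scaler_sumr -big_split/=; apply: eq_bigr => i _.
by rewrite !mxE scalerDl scalerA.
Qed.

Lemma combD n (g : 'I_n -> E) v w : comb g (v + w) = comb g v + comb g w.
Proof. by rewrite -[v]scale1r comb_linear !scale1r. Qed.

Lemma combZ n (g : 'I_n -> E) (a : R) v : comb g (a *: v) = a *: comb g v.
Proof.
rewrite /comb scaler_sumr; apply: eq_bigr => i _.
by rewrite mxE scalerA.
Qed.

Lemma lin_spanP n (g : 'I_n -> E) x : lin_span g x <-> exists v, x = comb g v.
Proof.
split=> [[c ->]|[v ->]]; last by exists (v 0).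
by exists (\row_i c i); rewrite /comb; apply: eq_bigr => i _; rewrite mxE.
Qed.

Lemma lin_span_comb n (g : 'I_n -> E) v : lin_span g (comb g v).
Proof. by apply/lin_spanP; exists v. Qed.

Lemma lin_span_gen n (g : 'I_n -> E) i : lin_span g (g i).
Proof.
exists (fun j => (j == i)%:R); rewrite (bigD1 i)//= eqxx scale1r big1 ?addr0//.
by move=> j /negPf ->; rewrite scale0r.
Qed.

Lemma comb_norm_row n (g : 'I_n -> E) (p : E -> R) :
  seminorm_on (lin_span g) p -> seminorm_on setT (p \o comb g).
Proof.
move=> ps; split=> [v w _ _|a v _] /=.
  by rewrite combD; apply: ps.1; exact: lin_span_comb.
by rewrite combZ; apply: ps.2; exact: lin_span_comb.
Qed.

Lemma free_subfamily n (v : 'I_n -> E) : exists m (h : 'I_m -> 'I_n),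
  free_family (v \o h) /\ lin_span (v \o h) = lin_span v.
Proof.
elim: n v => [|n IH] v.
  exists 0%N, id; split=> // w _; apply/rowP => -[] //.
have [vfree|/existsNP[w /not_implyP[w0 /eqP wn0]]] := pselect (free_family v).
  by exists n.+1, id.
have [i wi] : exists i, w 0 i != 0.
  apply/existsP; rewrite -negb_forall; apply: contra wn0 => /forallP h.
  by apply/eqP/rowP => i; rewrite mxE; exact/eqP.
have [m [h [hf hs]]] := IH (v \o lift i).
exists m, (lift i \o h); split; first exact: hf.
rewrite [LHS]hs eqEsubset; split=> [_ [c ->]|_ [c ->]].
  apply: (lin_closed_sum (lin_closed_span _)) => j.
  by apply: (lin_closedZ (lin_closed_span _)); exact: lin_span_gen.
have split_sum (F : 'I_n.+1 -> E) : \sum_j F j = F i + \sum_j F (lift i j).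
  exact: bigD1_ord.
have vi : v i = \sum_j (- (w 0 i)^-1 * w 0 (lift i j)) *: v (lift i j).
  move: w0; rewrite /comb split_sum => /eqP; rewrite addr_eq0 => /eqP w0.
  rewrite -[LHS](scalerK wi) w0 scalerN scaler_sumr -sumrN; apply: eq_bigr => j _.
  by rewrite scalerA mulNr scaleNr.
rewrite split_sum vi; apply: (lin_closedD (lin_closed_span _)).
  by apply: (lin_closedZ (lin_closed_span _)); eexists.
by exists (c \o lift i).
Qed.

End Comb.

Section RowNorms.
Context {R : realType} {d : nat}.
Implicit Types (p : 'rV[R]_d -> R) (v : 'rV[R]_d).

Lemma row_coord_le v i : `|v 0 i| <= `|v|.
Proof.
rewrite [leRHS]/Num.norm /= mx_normrE.
exact: (le_bigmax _ (fun ij : 'I_1 * 'I_d => `|v ij.1 ij.2|) (0, i)).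
Qed.

Lemma row_norm_le v (m : R) : 0 <= m -> (forall i, `|v 0 i| <= m) -> `|v| <= m.
Proof.
move=> m0 h; rewrite /Num.norm /= mx_normrE; apply: bigmax_le => // -[i j] _ /=.
by rewrite ord1.
Qed.

Lemma row_norm_attained v : `|v| = 0 \/ exists i, `|v| = `|v 0 i|.
Proof.
have -> : `|v| = \big[Order.max/0]_ij `|v ij.1 ij.2| by rewrite {1}/Num.norm /= mx_normrE.
have [->|[[i0 i] ->]] := bigmax_norm_attained (fun ij : 'I_1 * 'I_d => `|v ij.1 ij.2|).
  by left.
by right; exists i; rewrite ord1.
Qed.

Lemma lin_closedT {E : lmodType R} : lin_closed [set: E].
Proof. by []. Qed.

Lemma row_seminorm_upper p : seminorm_on setT p ->
  exists K, 0 < K /\ forall v, p v <= K * `|v|.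
Proof.
move=> ps; have p0 v : 0 <= p v by exact: (seminorm_on_ge0 lin_closedT ps).
exists (1 + \sum_i p 'e_i); split.
  by rewrite ltr_pwDl// sumr_ge0.
move=> v; rewrite {1}[v]row_sum_delta.
rewrite (le_trans (seminorm_on_sum lin_closedT ps _))//.
rewrite mulrDl mul1r -[leLHS]add0r lerD// mulr_suml.
apply: ler_sum => i _; rewrite ps.2// mulrC ler_wpM2l//; exact: row_coord_le.
Qed.

(** By the upper bound p is Lipschitz, so it attains a minimum on the compact unit sphere, and
    definiteness makes that minimum positive. *)
Lemma row_norm_lower p : seminorm_on setT p -> (forall v, p v = 0 -> v = 0) ->
  exists c, 0 < c /\ forall v, c * `|v| <= p v.
Proof.
move=> ps pdef; have p0 v : 0 <= p v by exact: (seminorm_on_ge0 lin_closedT ps).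
have [K [K0 pK]] := row_seminorm_upper ps.
pose S := [set v : 'rV[R]_d | `|v| = 1].
have [S0|/set0P/negP/negPn/eqP S0] := pselect (S !=set0); last first.
  (* The sphere is empty only if every vector is 0, and then any constant will do. *)
  exists 1; split=> // v; have [->|v0] := eqVneq v 0; first by rewrite normr0 mulr0.
  have : S (`|v|^-1 *: v).
    by rewrite /S/= normrZ normrV ?unitfE ?normr_eq0// normr_id mulVf// normr_eq0.
  by rewrite S0.
have pcont : continuous p.
  move=> v; apply/(@cvgrPdist_lt _ _ _ (nbhs v) _ p (p v)) => e e0.
  have eK : 0 < e / K by rewrite divr_gt0.
  apply/nbhs_ballP; exists (e / K) => //= w; rewrite -ball_normE/=.
  rewrite ltr_pdivlMr// mulrC => h; apply: le_lt_trans h.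
  apply: le_trans (pK (v - w)).
  have h1 : p v <= p (v - w) + p w by rewrite -{1}(subrK w v); exact: ps.1.
  have h2 : p w <= p (v - w) + p v.
    by rewrite -opprB (seminorm_onN ps)// -{1}(subrK v w); exact: ps.1.
  by rewrite ler_norml; apply/andP; split; lra.
have cS : compact S.
  apply: bounded_closed_compact.
    by exists 1; split=> // y y1 v /= ->; exact: ltW.
  apply: (preimage_closed (f := fun v : 'rV[R]_d => `|v|) (D := [set 1 : R])).
    by move=> v _; exact: norm_continuous.
  exact: closed_eq.
have [v vS vmin] := EVT_min_rV S0 cS (continuous_subspaceT pcont).
have v1 : `|v| = 1 by move: vS; rewrite inE.
exists (p v); split.
  rewrite lt_neqAle p0 andbT eq_sym; apply/eqP => /pdef v0.
  by move: v1; rewrite v0 normr0 => /eqP; rewrite eq_sym oner_eq0.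
move=> w; have [->|w0] := eqVneq w 0; first by rewrite normr0 mulr0.
have wn : 0 < `|w| by rewrite normr_gt0.
have : p v <= p (`|w|^-1 *: w).
  apply: vmin; rewrite inE /S /= normrZ normrV ?unitfE ?gt_eqF//.
  by rewrite normr_id mulVf ?gt_eqF.
by rewrite ps.2// normrV ?unitfE ?gt_eqF// normr_id mulrC ler_pdivlMr.
Qed.

End RowNorms.

(** Index arithmetic of the grid below: integers between -L and L are coded by naturals up to 2L. *)
Lemma shift_bound (z : int) (L : nat) : (- L%:Z <= z)%R -> (z <= L%:Z)%R ->
  (absz (z + L%:Z)%R < (2 * L).+1)%N /\ (absz (z + L%:Z)%R)%:Z = (z + L%:Z)%R.
Proof. by lia. Qed.

(* A rational grid of mesh 1/M in coordinates works: a remainder of the size of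
   the mesh is small for p0, hence for every r below p0. *)
Lemma finite_net (R : realType) (E : lmodType R) (b : nat -> E) d (g : 'I_d -> E)
    (p p0 : E -> R) (de : R) :
  vector_basis b -> (forall i, rational_vector b (g i)) -> free_family g ->
  seminorm_on (lin_span g) p -> (forall x, lin_span g x -> p x = 0 -> x = 0) ->
  seminorm_on (lin_span g) p0 -> 0 < de ->
  exists ws : seq E,
    (forall w, w \in ws -> [/\ lin_span g w, rational_vector b w & p w <= 1]) /\
    (forall r, seminorm_on (lin_span g) r ->
       (forall x, lin_span g x -> r x <= p0 x) ->
       (forall w, w \in ws -> r w <= 1) ->
       forall x, lin_span g x -> r x <= (1 + de) * p x).
Proof.
move=> hb grat gfree ps pdef p0s de0.
have [|c [c0 pc]] := row_norm_lower (comb_norm_row ps).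
  by move=> v pv; apply: gfree; apply: pdef => //; exact: lin_span_comb.
have [K1 [K10 pK1]] := row_seminorm_upper (comb_norm_row ps).
have [K2 [K20 pK2]] := row_seminorm_upper (comb_norm_row p0s).
pose K := K1 + K2; have K0 : 0 < K by rewrite addr_gt0.
have pK v : p (comb g v) <= K * `|v|.
  by rewrite (le_trans (pK1 v))// ler_wpM2r// lerDl ltW.
have p0K v : p0 (comb g v) <= K * `|v|.
  by rewrite (le_trans (pK2 v))// ler_wpM2r// lerDr ltW.
(* Vectors are scaled to p-value [s^-1], slightly inside the unit ball, to leave room for rounding
   to the grid. *)
pose s := 1 + de / 2; have s0 : 0 < s by rewrite /s; lra.
(* M makes the rounding error [K / M%:R], measured in p or in p0, at most [(de / 2) / s]. *)
pose M := Num.bound (K * s / (de / 2)).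
have de2 : 0 < de / 2 by lra.
have Ks0 : 0 <= K * s / (de / 2) by rewrite ltW// divr_gt0// mulr_gt0.
have KM : K * s / (de / 2) < M%:R by exact: archi_boundP.
have M0 : 0 < M%:R :> R by exact: le_lt_trans KM.
have KMs : K / M%:R * s <= de / 2.
  by rewrite mulrAC ler_pdivrMr// [leRHS]mulrC -ler_pdivrMr// ltW.
(* The scaled vectors have coordinates of size at most [c^-1]; after multiplication by M they lie
   within the range of the grid. *)
pose L := (Num.bound (M%:R / c)).+1.
have ML : M%:R / c <= L%:R - 1.
  rewrite /L -addn1 natrD addrK ltW//; apply: archi_boundP.
  by rewrite divr_ge0 ?ltW.
pose G (k : {ffun 'I_d -> 'I_(2 * L).+1}) : 'rV[R]_d :=
  \row_i (((k i)%:R - L%:R) / M%:R).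
exists [seq w <- [seq comb g (G k) | k <- enum {: {ffun 'I_d -> 'I_(2 * L).+1}}] | p w <= 1].
split=> [w|r rs rp0 rws x /lin_spanP[v ->]].
  rewrite mem_filter => /andP[pw /mapP[k _ wE]]; split=> //.
    by rewrite wE; exact: lin_span_comb.
  rewrite wE; apply: (rational_vector_comb hb) => // i; rewrite mxE.
  apply: rationalM; last by apply: rationalV; exact: rational_nat.
  by apply: rationalB; exact: rational_nat.
have clg := lin_closed_span g.
have [pv0|pvn0] := eqVneq (p (comb g v)) 0.
  rewrite (pdef _ (lin_span_comb g v) pv0) (seminorm_on0 clg ps).
  by rewrite (seminorm_on0 clg rs) mulr0.
have pv_gt0 : 0 < p (comb g v).
  by rewrite lt_neqAle eq_sym pvn0 (seminorm_on_ge0 clg ps)//; exact: lin_span_comb.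
pose t := p (comb g v) * s; have t0 : 0 < t by rewrite mulr_gt0.
pose v' : 'rV[R]_d := t^-1 *: v.
have vE : v = t *: v' by rewrite scalerA divff ?gt_eqF ?scale1r.
have pv' : p (comb g v') = s^-1.
  rewrite combZ ps.2//; last exact: lin_span_comb.
  by rewrite ger0_norm ?invr_ge0 ?ltW// /t invfM mulrAC mulVf// mul1r.
clearbody v'; have v'c : `|v'| <= c^-1.
  rewrite -[leRHS]mulr1 ler_pdivlMl// (le_trans (pc v'))//=.
  by rewrite pv' invf_le1// /s; lra.
pose k := [ffun i : 'I_d => inord (absz (Num.floor (M%:R * v' 0 i) + L%:Z))] : {ffun 'I_d -> 'I_(2 * L).+1}.
have kE i : (k i)%:R - L%:R = (Num.floor (M%:R * v' 0 i))%:~R :> R.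
  have vi : `|M%:R * v' 0 i| <= L%:R - 1.
    rewrite normrM (ger0_norm (ltW M0)); apply: le_trans ML.
    by rewrite ler_pM2l// (le_trans (row_coord_le v' i)).
  move: vi; rewrite ler_norml => /andP[vi1 vi2].
  have f1 : (- L%:Z <= Num.floor (M%:R * v' 0 i)).
    rewrite floor_ge_int rmorphN/= -pmulrn; lra.
  have f2 : (Num.floor (M%:R * v' 0 i) <= L%:Z).
    rewrite -(ler_int R) (le_trans (floor_le _))// -pmulrn; lra.
  have [kL kZ] := shift_bound f1 f2.
  by rewrite ffunE inordK// pmulrn kZ rmorphD/= addrK.
have vG : `|v' - G k| <= M%:R^-1.
  apply: row_norm_le; first by rewrite invr_ge0 ltW.
  move=> i; rewrite !mxE kE.
  have := floor_le (M%:R * v' 0 i); have := floorD1_gt (M%:R * v' 0 i).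
  rewrite rmorphD/=; set fl := (Num.floor _)%:~R => h1 h2.
  have -> : v' 0 i - fl / M%:R = (M%:R * v' 0 i - fl) / M%:R.
    by rewrite mulrBl mulrAC divff ?mul1r// gt_eqF.
  have Mi : 0 < M%:R^-1 :> R by rewrite invr_gt0.
  rewrite normrM (ger0_norm (ltW Mi)) -[leRHS]mul1r ler_pM2r//.
  by rewrite ler_norml; apply/andP; split; lra.
have KvG : K * `|v' - G k| <= K / M%:R by rewrite ler_pM2l.
have KMs' : K / M%:R <= (de / 2) / s by rewrite ler_pdivlMr.
(* The rounded vector stays in the ball, since [s^-1 + (de / 2) / s = 1]; hence it belongs to the
   net. *)
have pG : p (comb g (G k)) <= 1.
  have -> : comb g (G k) = comb g v' + comb g (- (v' - G k)).
    by rewrite -combD opprB addrCA subrr addr0.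
  rewrite (le_trans (ps.1 _ _ _ _)) ?pv'//; try exact: lin_span_comb.
  have := pK (- (v' - G k)); rewrite normrN => h.
  have : s^-1 + de / 2 / s = 1.
    by rewrite -{1}[s^-1]mul1r -mulrDl divff// gt_eqF.
  lra.
have rG : r (comb g (G k)) <= 1.
  by apply: rws; rewrite mem_filter pG; apply: map_f; rewrite mem_enum.
have rv' : r (comb g v') <= 1 + K / M%:R.
  have -> : comb g v' = comb g (G k) + comb g (v' - G k).
    by rewrite -combD addrC subrK.
  rewrite (le_trans (rs.1 _ _ _ _))//; try exact: lin_span_comb.
  rewrite lerD// (le_trans (rp0 _ (lin_span_comb _ _)))//.
  exact: le_trans (p0K _) KvG.
(* Undoing the scaling multiplies [1 + K / M%:R] by s, and the result is at most
   [1 + de / 2 + de / 2]. *)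
rewrite vE combZ rs.2 ?ps.2//; try exact: lin_span_comb.
rewrite pv' (ger0_norm (ltW t0)) [leRHS]mulrCA ler_pM2l//.
apply: le_trans rv' _; rewrite ler_pdivlMr// mulrDl mul1r {1}/s; lra.
Qed.

(** * Rational approximation of norms *)

Section Extension.
Context {R : realType} {E : lmodType R}.
Variables (b : nat -> E) (co : nat -> {linear E -> R^o}).
Hypothesis hb : vector_basis b.
Hypothesis coS : forall x, exists n, (forall k, (n <= k)%N -> co k x = 0) /\
  x = \sum_(i < n) (co i x : R) *: b i.
Hypothesis cob : forall k l, co k (b l) = (k == l)%:R.
Variables (S : normed_subspace E) (N a : nat).
Hypothesis Srat : rational_subspace b S.
Hypothesis coN : forall x k, carrier S x -> (N <= k)%N -> co k x = 0.

(* The basis vectors with indices in [N, N + a) are independent of S, so that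
   extend is the direct sum of S and a copy of R^a. *)
Definition tail (v : 'rV[R]_a) : E := comb (fun i : 'I_a => b (N + i)%N) v.
Definition tail_coord (x : E) : 'rV[R]_a := \row_i (co (N + i)%N x : R).
(** The projection that kills the added copy of R^a; on [extend] it is the component in S. *)
Definition base_part (x : E) : E := x - tail (tail_coord x).
Definition extend : set E := [set x | carrier S (base_part x)].

Let clS : lin_closed (carrier S) := rational_subspace_closed Srat.

Lemma tail_coord_linear : linear tail_coord.
Proof. by move=> c x y; apply/rowP => i; rewrite !mxE linearP. Qed.

Lemma tailK v : tail_coord (tail v) = v.
Proof.
apply/rowP => i; rewrite mxE /tail /comb linear_sum (bigD1 i)//= big1 ?addr0.
  by rewrite linearZ/= cob eqxx; exact: mulr1.
move=> j ji; rewrite linearZ/= cob eqn_add2l.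
have -> : (i == j :> nat) = false by rewrite eq_sym; exact: negPf ji.
by rewrite scaler0.
Qed.

Lemma tail_coord0 x : carrier S x -> tail_coord x = 0.
Proof. by move=> Sx; apply/rowP => i; rewrite !mxE coN// leq_addr. Qed.

Lemma tail0 : tail 0 = 0.
Proof. by rewrite /tail /comb big1// => i _; rewrite mxE scale0r. Qed.

Lemma base_part_linear : linear base_part.
Proof.
move=> c x y; rewrite /base_part tail_coord_linear /tail comb_linear.
by rewrite scalerBr opprD addrACA.
Qed.

Lemma base_partD x y : base_part (x + y) = base_part x + base_part y.
Proof. by have := base_part_linear 1 x y; rewrite !scale1r. Qed.

Lemma base_part0 : base_part 0 = 0.
Proof. by have := base_part_linear (-1) 0 0; rewrite !scaleN1r !addNr. Qed.

Lemma base_partZ (c : R) x : base_part (c *: x) = c *: base_part x.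
Proof. by have := base_part_linear c x 0; rewrite base_part0 !addr0. Qed.

Lemma base_part_id x : carrier S x -> base_part x = x.
Proof. by move=> Sx; rewrite /base_part tail_coord0// tail0 subr0. Qed.

Lemma base_part_tail v : base_part (tail v) = 0.
Proof. by rewrite /base_part tailK subrr. Qed.

Lemma extend_closed : lin_closed extend.
Proof.
split; first by rewrite /extend/= base_part0; exact: clS.1.
by move=> c x y Ex Ey; rewrite /extend/= base_part_linear; exact: clS.2.
Qed.

Lemma sub_extend x : carrier S x -> extend x.
Proof. by move=> Sx; rewrite /extend/= base_part_id. Qed.

Lemma extend_tail v : extend (tail v).
Proof. by rewrite /extend/= base_part_tail; exact: clS.1. Qed.

Lemma extend_span : exists n (v : 'I_n -> E),
  (forall i, rational_vector b (v i)) /\ extend = lin_span v.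
Proof.
have [[n [v [vrat Sv]]] _ _] := Srat.
pose w (i : 'I_(n + a)) := match fintype.split i with inl j => v j | inr j => b (N + j)%N end.
have wl j : w (lshift a j) = v j by rewrite /w (unsplitK (inl j : 'I_n + 'I_a)).
have wr j : w (rshift n j) = b (N + j)%N by rewrite /w (unsplitK (inr j : 'I_n + 'I_a)).
exists (n + a)%N, w; split.
  by move=> i; rewrite /w; case: (fintype.split i) => j; [exact: vrat|exact: rational_basis_vector].
rewrite eqEsubset; split=> [x Ex|_ [c ->]].
  have clw := lin_closed_span w.
  rewrite -[x](subrK (tail (tail_coord x))); apply: (lin_closedD clw).
    move: Ex; rewrite /extend/= Sv => -[c]; rewrite /base_part => ->.
    apply: (lin_closed_sum clw) => i; apply: (lin_closedZ clw).
    by rewrite -wl; exact: lin_span_gen.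
  apply: (lin_closed_sum clw) => i; apply: (lin_closedZ clw).
  by rewrite -wr; exact: lin_span_gen.
apply: (lin_closed_sum extend_closed) => i; apply: (lin_closedZ extend_closed).
rewrite /w; case: (fintype.split i) => j; first by apply: sub_extend; rewrite Sv; exact: lin_span_gen.
rewrite (_ : b _ = tail 'e_j); first exact: extend_tail.
rewrite /tail /comb (bigD1 j)//= big1 ?addr0 ?mxE ?eqxx ?scale1r//.
by move=> k /negPf kj; rewrite mxE kj andbF scale0r.
Qed.

Lemma rational_tail_coord x i : rational_vector b x -> rational (tail_coord x 0 i).
Proof. by move=> /(rational_vectorP coS cob) h; rewrite mxE; exact: h. Qed.

Lemma rational_tail (v : 'rV[R]_a) : (forall i, rational (v 0 i : R)) -> rational_vector b (tail v).
Proof.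
move=> vr; apply: (rational_vector_comb hb) => // i; exact: rational_basis_vector.
Qed.

Lemma rational_base_part x : rational_vector b x -> rational_vector b (base_part x).
Proof.
move=> xr; apply/(rational_vectorP coS cob) => k; rewrite linearB.
apply: rationalB; first exact: ((rational_vectorP coS cob x).1 xr k).
apply: ((rational_vectorP coS cob _).1 (rational_tail _) k) => i.
exact: rational_tail_coord.
Qed.

(** The l1-sum of the norm of S and C times the max norm on R^a. It restricts to the norm of S. *)
Definition coarse_norm (C : R) (x : E) : R := snorm S (base_part x) + C * `|tail_coord x|.

Lemma coarse_rational (C : nat) : (0 < C)%N ->
  rational_subspace b (NormedSubspace extend (coarse_norm C%:R)).
Proof.
move=> C0; have C0' : 0 < C%:R :> R by rewrite ltr0n.
have [_ /is_normP[Ssemi Sdef] [k [f [f1 f2 f3]]]] := Srat.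
have S0 z : extend z -> 0 <= snorm S (base_part z).
  by move=> Ez; rewrite (seminorm_on_ge0 clS Ssemi).
split=> /=; first exact: extend_span.
  apply/is_normP; split=> /=.
    split=> [x y Ex Ey|c x Ex]; rewrite /coarse_norm.
      rewrite base_partD -[x in tail_coord (x + y)]scale1r tail_coord_linear scale1r.
      have := Ssemi.1 _ _ Ex Ey; have := ler_normD (tail_coord x) (tail_coord y).
      rewrite -(ler_pM2l C0') mulrDr; lra.
    rewrite base_partZ Ssemi.2// -[c *: x]addr0 tail_coord_linear (tail_coord0 clS.1) addr0.
    by rewrite normrZ mulrDr; ring.
  move=> x Ex; rewrite /coarse_norm => h.
  have t0 : 0 <= C%:R * `|tail_coord x| by rewrite mulr_ge0.
  have h0 := S0 x Ex.
  have tx : tail_coord x = 0.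
    apply/eqP; rewrite -normr_eq0 -(mulrI_eq0 _ (mulfI (negbT (gt_eqF C0')))).
    by apply/eqP; lra.
  have hx : base_part x = x by rewrite /base_part tx tail0 subr0.
  by apply: Sdef; rewrite -hx//; lra.
pose g (o : option 'I_k) : E -> R^o := if o is Some i then f i else fun=> 0.
have lg o : linear_on (carrier S) (g o).
  by case: o => [i|] //= c x y _ _; rewrite scaler0 addr0.
pose e (o : option 'I_a) (x : E) : R := if o is Some i then tail_coord x 0 i else 0.
(* The norm of an l1-sum is a maximum of absolute values of sums of functionals of the two norms;
   only their relative sign has to vary. *)
pose h (j : option 'I_k * option 'I_a * bool) (x : E) : R^o :=
  (g j.1.1 (base_part x) : R) + C%:R * ((-1) ^+ j.2 * e j.1.2 x).
apply: (@rational_norm_fin _ _ b _ _ h) => /= [j c x y|j x Ex xr|x Ex].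
- rewrite !inE => Ex Ey; rewrite /h base_part_linear (linear_onP (lg _))//.
  rewrite -[c *: g _ _]/(c * g _ _) -[c *: (_ + _)]/(c * (_ + _)).
  have -> : e j.1.2 (c *: x + y) = c * e j.1.2 x + e j.1.2 y.
    by rewrite /e; case: (j.1.2) => [i|]; rewrite ?mulr0 ?addr0// tail_coord_linear !mxE.
  ring.
- have hr := rational_base_part xr.
  apply: rationalD.
    rewrite /g; case: (j.1.1) => [i|]; last exact: rational0.
    exact: f2.
  apply: rationalM; first exact: rational_nat.
  apply: rationalM; first exact: rational_sign.
  rewrite /e; case: (j.1.2) => [i|]; last exact: rational0.
  exact: rational_tail_coord.
- have gle o : `|g o (base_part x)| <= snorm S (base_part x).
    case: o => [i|] /=; last by rewrite normr0 S0.
    by rewrite f3 ?inE//; exact: (le_bigmax _ (fun i => `|f i (base_part x)|)).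
  have ele o : `|e o x| <= `|tail_coord x|.
    by case: o => [i|] /=; [exact: row_coord_le|rewrite normr0].
  apply: eq_bigmax_norm => [j||].
  + rewrite (le_trans (ler_normD _ _))// lerD//.
    by rewrite !normrM normrX normrN1 expr1n mul1r ger0_norm ?ler_wpM2l// ltW.
  + by rewrite addr_ge0 ?S0// mulr_ge0// ltW.
  + right.
    have [oi goi] : exists o, snorm S (base_part x) = `|g o (base_part x)|.
      rewrite f3 ?inE//.
      have [->|[i ->]] := bigmax_norm_attained (fun i => `|f i (base_part x)| : R).
        by exists None; rewrite normr0.
      by exists (Some i).
    have [oj eoj] : exists o', `|tail_coord x| = `|e o' x|.
      have [->|[i ->]] := row_norm_attained (tail_coord x).
        by exists None; rewrite normr0.
      by exists (Some i).
    (* The relative sign is chosen so that both terms have the same sign and their absolute values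
       add up. *)
    exists (oi, oj, (g oi (base_part x) < 0) (+) (e oj x < 0)).
    rewrite /coarse_norm goi eoj /h /= signr_addb -mulrA -normrEsign.
    rewrite {2}[g oi (base_part x)]numEsign.
    set u := `|_|; set w := `|_|; set sg := (-1) ^+ _.
    rewrite (_ : sg * u + C%:R * (sg * w) = sg * (u + C%:R * w)); last by ring.
    have uw : 0 <= u + C%:R * w .
      by apply: addr_ge0; [exact: normr_ge0|apply: mulr_ge0; [exact: ltW|exact: normr_ge0]].
    by rewrite normrM normrX normrN1 expr1n mul1r ger0_norm.
Qed.

(* The last clause is the maximality of S', from which operators out of S' are
   shown to be nonexpansive. *)
Lemma rationalise (p : E -> R) (de : R) (ws0 : seq E) :
    seminorm_on extend p -> (forall x, extend x -> p x = 0 -> x = 0) ->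
    (forall x, carrier S x -> p x = snorm S x) -> 0 < de ->
    (forall w, w \in ws0 -> [/\ extend w, rational_vector b w & p w <= 1]) ->
  exists (S' : normed_subspace E) (ws : seq E),
    [/\ carrier S' = extend, rational_subspace b S',
        forall x, extend x -> p x <= snorm S' x <= (1 + de) * p x,
        forall x, carrier S x -> snorm S' x = snorm S x &
        [/\ forall w, w \in ws -> [/\ extend w, rational_vector b w & p w <= 1],
            forall w, w \in ws0 -> snorm S' w <= 1 &
            forall r, seminorm_on extend r ->
              (forall x, carrier S x -> r x <= snorm S x) ->
              (forall x, extend x -> r x <= 2 * p x) ->
              (forall w, w \in ws -> r w <= 1) ->
              forall x, extend x -> r x <= snorm S' x]].
Proof.
move=> ps pdef pS de0 hws0.
have p_ge0 x : extend x -> 0 <= p x by exact: (seminorm_on_ge0 extend_closed ps).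
have pt : seminorm_on setT (p \o tail).
  split=> [v w _ _|c v _] /=.
    by rewrite /tail combD; apply: ps.1; exact: extend_tail.
  by rewrite /tail combZ ps.2//; exact: extend_tail.
have [K [K0 pK]] := row_seminorm_upper pt.
(* With [2 * K <= C%:R] any seminorm below [2 * p] is below the coarse norm on the added
   coordinates; the successor keeps C positive. *)
pose C := (Num.bound (2 * K)).+1.
have KC : 2 * K <= C%:R.
  apply: ltW; apply: lt_le_trans (archi_boundP _) _; first by lra.
  by rewrite ler_nat.
pose S1 := NormedSubspace extend (coarse_norm C%:R).
have S1rat : rational_subspace b S1 by exact: coarse_rational.
have [_ /is_normP[S1semi _] _] := S1rat.
have S1S x : carrier S x -> snorm S1 x = snorm S x.
  by move=> Sx; rewrite /S1/= /coarse_norm base_part_id// tail_coord0// normr0 mulr0 addr0.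
have below r : seminorm_on extend r -> (forall x, carrier S x -> r x <= snorm S x) ->
    (forall x, extend x -> r x <= 2 * p x) -> forall x, extend x -> r x <= snorm S1 x.
  move=> rs rS rp x Ex; rewrite -(subrK (tail (tail_coord x)) x).
  rewrite (le_trans (rs.1 _ _ (sub_extend Ex) (extend_tail _)))// subrK.
  rewrite /S1/= /coarse_norm lerD ?rS//.
  rewrite (le_trans (rp _ (extend_tail _)))//.
  have := pK (tail_coord x) => /= h.
  have : 2 * K * `|tail_coord x| <= C%:R * `|tail_coord x| by rewrite ler_wpM2r.
  lra.
have [n0 [v0 [v0rat Ev0]]] := extend_span.
have [m [h [hfree hspan]]] := free_subfamily v0.
(* Everything to be compared lies below the coarse norm, so that norm controls the rounding errors
   of the net. *)
have [||||||ws1 [hws1 net]] := @finite_net R E b m (v0 \o h) p (snorm S1) de hb.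
- by move=> i; exact: v0rat.
- exact: hfree.
- by rewrite hspan -Ev0.
- by rewrite hspan -Ev0.
- by rewrite hspan -Ev0.
- exact: de0.
rewrite hspan -Ev0 in hws1 net.
have hws w : w \in ws0 ++ ws1 -> [/\ extend w, rational_vector b w & p w <= 1].
  by rewrite mem_cat => /orP[]; [exact: hws0|exact: hws1].
have [|S' [cS' S'rat S'le S'ws S'max]] := adjoin_generators S1rat (ws := ws0 ++ ws1).
  by move=> w /hws[].
rewrite /= in cS' S'le S'max.
have pS' x : extend x -> p x <= snorm S' x.
  apply: S'max => //; last by move=> w /hws[].
  apply: below => // [x' /pS->//|x' Ex']; have := p_ge0 x' Ex'; lra.
exists S', (ws0 ++ ws1); split=> //.
- move=> x Ex; rewrite pS'//=; apply: net => //.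
    by have [_ /is_normP[]] := S'rat; rewrite cS'.
  by move=> w hw; apply: S'ws; rewrite mem_cat hw orbT.
(* On S the new norm is squeezed between p and the coarse norm, which both equal the norm of S
   there. *)
- move=> x Sx; apply/eqP; rewrite eq_le -{1}(S1S x Sx) -(pS x Sx).
  by rewrite S'le ?pS'//; exact: sub_extend.
- split=> // [w hw|r rs rS rp rw]; first by apply: S'ws; rewrite mem_cat hw.
  by apply: S'max => //; exact: below.
Qed.

End Extension.

(** * The pushout norm *)

Section PushoutNorm.
Context {R : realType} {X W : normedModType R}.
Variables (X0 : set X) (i : X -> W).
Hypothesis clX0 : lin_closed X0.
Hypothesis ilin : linear_on X0 i.
Hypothesis iiso : forall x, X0 x -> `|i x| = `|x|.

(* The norm of the pushout of the inclusion of X0 in X and i, pulled back to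
   the direct sum; it is only a seminorm there. *)
Definition pushout_norm (x : X) (y : W) : R :=
  inf [set `|x - z| + `|y + i z| | z in X0].

Let S x y := [set `|x - z| + `|y + i z| | z in X0].

Let S_lb x y : has_lbound (S x y).
Proof. by exists 0 => _ [z _ <-]; rewrite addr_ge0. Qed.

Let S_nonempty x y : S x y !=set0.
Proof. by eexists; exists 0; [exact: clX0.1|reflexivity]. Qed.

Lemma pushout_norm_le x y z : X0 z -> pushout_norm x y <= `|x - z| + `|y + i z|.
Proof. by move=> Xz; apply: ge_inf; [exact: S_lb|exists z]. Qed.

Lemma le_pushout_norm x y m : (forall z, X0 z -> m <= `|x - z| + `|y + i z|) ->
  m <= pushout_norm x y.
Proof. by move=> h; apply: lb_le_inf; [exact: S_nonempty|move=> _ [z Xz <-]; exact: h]. Qed.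

Lemma pushout_norm_ge0 x y : 0 <= pushout_norm x y.
Proof. by apply: le_pushout_norm => z _; rewrite addr_ge0. Qed.

(** The choice z = x. With y close to [- i x] it says that x and [i x] are identified in the
    pushout. *)
Lemma pushout_norm_amalgam x y : X0 x -> pushout_norm x y <= `|y + i x|.
Proof. by move=> /(pushout_norm_le x y); rewrite subrr normr0 add0r. Qed.

(** The choice z = 0 gives one bound; the other is the triangle inequality, as [i z] has the norm of
    z. *)
Lemma pushout_norm_inl x : pushout_norm x 0 = `|x|.
Proof.
apply/eqP; rewrite eq_le; apply/andP; split.
  have := pushout_norm_le x 0 clX0.1.
  by rewrite subr0 add0r (linear_on0 clX0 ilin) normr0 addr0.
apply: le_pushout_norm => z Xz; rewrite add0r iiso//.
by rewrite -{1}(subrK z x) ler_normD.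
Qed.

Lemma pushout_norm_inr y : pushout_norm 0 y = `|y|.
Proof.
apply/eqP; rewrite eq_le; apply/andP; split.
  have := pushout_norm_le 0 y clX0.1.
  by rewrite subr0 (linear_on0 clX0 ilin) normr0 addr0 add0r.
apply: le_pushout_norm => z Xz; rewrite sub0r normrN -(iiso Xz).
by rewrite addrC -{1}(addrK (i z) y) ler_normB.
Qed.

Lemma pushout_normD x y x' y' :
  pushout_norm (x + x') (y + y') <= pushout_norm x y + pushout_norm x' y'.
Proof.
rewrite -lerBlDr; apply: le_pushout_norm => z Xz.
rewrite lerBlDr [leRHS]addrC -lerBlDr; apply: le_pushout_norm => z' Xz'.
rewrite lerBlDr; have Xzz := lin_closedD clX0 Xz Xz'.
apply: le_trans (pushout_norm_le _ _ Xzz) _.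
rewrite (linear_onD ilin)//.
rewrite opprD [x + x' + _]addrACA [y + y' + _]addrACA.
have := ler_normD (x - z) (x' - z'); have := ler_normD (y + i z) (y' + i z').
lra.
Qed.

Lemma pushout_normZ_le (a : R) x y :
  pushout_norm (a *: x) (a *: y) <= `|a| * pushout_norm x y.
Proof.
have [->|a0] := eqVneq a 0.
  by rewrite !scale0r pushout_norm_inl !normr0 mul0r.
rewrite -ler_pdivrMl ?normr_gt0//; apply: le_pushout_norm => z Xz.
rewrite ler_pdivrMl ?normr_gt0//.
apply: le_trans (pushout_norm_le _ _ (lin_closedZ clX0 a Xz)) _.
by rewrite (linear_onZ clX0 ilin)// -scalerBr -scalerDr !normrZ mulrDr.
Qed.

(** The missing inequality is the previous one for the inverse scalar. *)
Lemma pushout_normZ (a : R) x y :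
  pushout_norm (a *: x) (a *: y) = `|a| * pushout_norm x y.
Proof.
apply/eqP; rewrite eq_le pushout_normZ_le /=.
have [->|a0] := eqVneq a 0; first by rewrite normr0 mul0r pushout_norm_ge0.
rewrite -ler_pdivlMl ?normr_gt0// -normfV.
have := pushout_normZ_le a^-1 (a *: x) (a *: y).
by rewrite !scalerA mulVf// !scale1r.
Qed.

End PushoutNorm.

(** Functoriality of the pushout: a competitor z in the infimum on the right yields the competitor
    [T z] on the left, at no greater cost. *)
Lemma pushout_norm_map (R : realType) (X W Y Z : normedModType R)
    (X0 : set X) (i : X -> W) (Y0 : set Y) (j : Y -> Z)
    (T : {linear X -> Y}) (F : {linear W -> Z}) x y :
  lin_closed X0 ->
  (forall x, `|T x| <= `|x|) -> (forall y, `|F y| <= `|y|) ->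
  (forall x, X0 x -> Y0 (T x)) -> (forall x, X0 x -> F (i x) = j (T x)) ->
  pushout_norm Y0 j (T x) (F y) <= pushout_norm X0 i x y.
Proof.
move=> clX0 hT hF TX0 Fi; apply: le_pushout_norm => // z Xz.
apply: le_trans (pushout_norm_le _ _ _ (TX0 _ Xz)) _.
by rewrite -Fi// -linearB -linearD lerD.
Qed.

(** * Adapted bases *)

Section FiniteDimension.
Context {R : realType}.

Lemma coordinates (X : lmodType R) : finite_dimensional X ->
  exists a (phi : {linear 'rV[R]_a -> X}) (psi : {linear X -> 'rV[R]_a}),
    cancel phi psi /\ cancel psi phi.
Proof.
move=> [n [v hv]]; have [a [h [gfree gspan]]] := free_subfamily v.
rewrite hv in gspan; set g := v \o h in gfree gspan.
have [phi phiE] := exists_linear (comb_linear g).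
have phi_inj : injective phi.
  move=> x y /eqP; rewrite -subr_eq0 -linearB phiE => /eqP/gfree/eqP.
  by rewrite subr_eq0 => /eqP.
have /choice[psi psiE] : forall x : X, exists w, phi w = x.
  move=> x; have /lin_spanP[w ->] : lin_span g x by rewrite gspan.
  by exists w; rewrite phiE.
have psi_lin : linear psi by move=> c x y; apply: phi_inj; rewrite linearP !psiE.
have [psi' psi'E] := exists_linear psi_lin.
exists a, phi, psi'; split=> [w|x]; rewrite psi'E ?psiE//.
by apply: phi_inj; rewrite psiE.
Qed.

Lemma mulmx_linear m n (A : 'M[R]_(m, n)) : linear (fun v : 'rV[R]_m => v *m A).
Proof. by move=> c v w; rewrite mulmxDl scalemxAl. Qed.

(* In bases adapted to T its matrix is a partial identity, hence rational. *)
Lemma adapted_coordinates (X Y : lmodType R) (T : {linear X -> Y}) :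
    finite_dimensional X -> finite_dimensional Y ->
  exists a c r (phi : {linear 'rV[R]_a -> X}) (psi : {linear X -> 'rV[R]_a})
    (phi' : {linear 'rV[R]_c -> Y}) (psi' : {linear Y -> 'rV[R]_c}),
    [/\ cancel phi psi, cancel psi phi, cancel phi' psi', cancel psi' phi' &
        forall v, T (phi v) = phi' (v *m pid_mx r)].
Proof.
move=> /coordinates[a [phi [psi [phiK psiK]]]] /coordinates[c [phi' [psi' [phi'K psi'K]]]].
pose A : 'M[R]_(a, c) := lin1_mx (psi' \o T \o phi).
have AE v : v *m A = psi' (T (phi v)) by rewrite /A mul_rV_lin1.
have [f fE] := exists_linear (mulmx_linear (invmx (col_ebase A))).
have [f' f'E] := exists_linear (mulmx_linear (col_ebase A)).
have [h hE] := exists_linear (mulmx_linear (row_ebase A)).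
have [h' h'E] := exists_linear (mulmx_linear (invmx (row_ebase A))).
have uL := col_ebase_unit A; have uU := row_ebase_unit A.
exists a, c, (\rank A), (phi \o f), (f' \o psi), (phi' \o h), (h' \o psi'); split.
- by move=> v /=; rewrite phiK fE f'E mulmxKV.
- by move=> v /=; rewrite fE f'E mulmxK ?psiK.
- by move=> v /=; rewrite phi'K hE h'E mulmxK.
- by move=> v /=; rewrite hE h'E mulmxKV ?psi'K.
- move=> v /=; apply: (can_inj psi'K); rewrite phi'K -AE fE hE.
  by rewrite -{2}(mulmx_ebase A) !mulmxA mulmxKV.
Qed.

(** Induction on n: A meets the span of all generators but the first in a finitely spanned space,
    and at most one vector with nonzero first coefficient has to be added. *)
Lemma subspace_span (X : lmodType R) n (v : 'I_n -> X) (A : set X) :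
  lin_closed A -> A `<=` lin_span v -> exists m (w : 'I_m -> X), A = lin_span w.
Proof.
elim: n v A => [|n IH] v A clA Av.
  exists 0%N, v; rewrite eqEsubset; split=> // _ [c ->].
  by rewrite big_ord0; exact: clA.1.
pose v' := v \o lift ord0.
have clv' := lin_closed_span v'.
have [||m [w wE]] := IH v' (A `&` lin_span v').
- split; first by split; [exact: clA.1|exact: clv'.1].
  by move=> a x y [Ax vx] [Ay vy]; split; [exact: clA.2|exact: clv'.2].
- by move=> x [].
have [Av'|/existsNP[a0 /not_implyP[Aa0 v'a0]]] := pselect (forall x, A x -> lin_span v' x).
  by exists m, w; rewrite -wE eqEsubset; split=> [x Ax|x []//]; split => //; exact: Av'.
have [c0 a0E] := Av _ Aa0.
have c00 : c0 ord0 != 0.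
  apply/eqP => c00; apply: v'a0; rewrite a0E big_ord_recl c00 scale0r add0r.
  by exists (c0 \o lift ord0).
pose w' (i : 'I_m.+1) := if unlift ord0 i is Some j then w j else a0.
have w'0 : w' ord0 = a0 by rewrite /w' unlift_none.
have w'S j : w' (lift ord0 j) = w j by rewrite /w' liftK.
have Aw j : A (w j).
  by have : (A `&` lin_span v') (w j) by [rewrite wE; exact: lin_span_gen]; case.
exists m.+1, w'; rewrite eqEsubset; split=> [x Ax|_ [c ->]]; last first.
  rewrite big_ord_recl w'0; apply: (lin_closedD clA); first exact: (lin_closedZ clA).
  apply: (lin_closed_sum clA) => j; rewrite w'S; exact: (lin_closedZ clA).
have [c xE] := Av _ Ax.
have : (A `&` lin_span v') (x - (c ord0 / c0 ord0) *: a0).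
  split; first by apply: (lin_closedB clA) => //; exact: (lin_closedZ clA).
  rewrite xE a0E !big_ord_recl scalerDr scalerA divfK// opprD addrACA subrr add0r.
  apply: (lin_closedB clv'); first by exists (c \o lift ord0).
  by apply: (lin_closedZ clv'); exists (c0 \o lift ord0).
rewrite wE => -[d dE].
exists (fun i => if unlift ord0 i is Some j then d j else c ord0 / c0 ord0).
rewrite big_ord_recl unlift_none w'0 -{1}(subrK ((c ord0 / c0 ord0) *: a0) x) dE addrC.
by congr (_ + _); apply: eq_bigr => j _; rewrite liftK w'S.
Qed.

End FiniteDimension.

(** * Operator norms as pointwise bounds *)

Section OperatorNorm.
Context {R : realType} {E E' : lmodType R}.
Variables (S : normed_subspace E) (S' : normed_subspace E') (f : E -> E').

Lemma opnorm_le (m : R) : 0 <= m ->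
  (forall x, carrier S x -> snorm S' (f x) <= m * snorm S x) ->
  (opnorm S S' f <= m%:E)%E.
Proof.
move=> m0 h; apply: ge_ereal_sup => _ [x [Sx x1] <-]; rewrite lee_fin.
by rewrite (le_trans (h x Sx))// ler_piMr.
Qed.

Lemma opnorm_le1 x : lin_closed (carrier S) -> lin_closed (carrier S') ->
  is_norm S -> is_norm S' ->
  nonexpansive S S' f -> carrier S x -> snorm S' (f x) <= snorm S x.
Proof.
move=> clS clS' /is_normP[ps pdef] /is_normP[ps' _] [fS flin f1] Sx.
have Sfx : carrier S' (f x) by apply: fS; exists x.
have [x0|x0] := eqVneq (snorm S x) 0.
  by rewrite (pdef _ Sx x0) (linear_on0 clS flin) (seminorm_on0 clS' ps') (seminorm_on0 clS ps).
have xgt0 : 0 < snorm S x by rewrite lt_neqAle eq_sym x0 (seminorm_on_ge0 clS ps).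
have ni : 0 <= (snorm S x)^-1 by rewrite invr_ge0 ltW.
have Sx' := lin_closedZ clS (snorm S x)^-1 Sx.
have : ((snorm S' (f ((snorm S x)^-1 *: x)))%:E <= 1%:E)%E.
  apply: le_trans f1; apply: ereal_sup_ubound; exists ((snorm S x)^-1 *: x) => //.
  by split=> //; rewrite ps.2// (ger0_norm ni) mulVf.
rewrite lee_fin (linear_onZ clS flin)// ps'.2// (ger0_norm ni).
by rewrite mulrC ler_pdivrMr// mul1r.
Qed.

End OperatorNorm.

Lemma whole_closed (R : realType) (X : normedModType R) : lin_closed (carrier (whole X)).
Proof. by []. Qed.

Lemma whole_norm (R : realType) (X : normedModType R) : is_norm (whole X).
Proof.
by split=> [x y _ _|x _ a|x _] /=; [exact: ler_normD|exact: normrZ|exact: normr0_eq0].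
Qed.

(** * Chains and their completions *)

Section Chain.
Context {R : realType} {E : lmodType R} {W : completeNormedModType R}.
Variables (S : nat -> normed_subspace E) (iota : E -> W).
Hypothesis clS : forall n, lin_closed (carrier (S n)).
Hypothesis nested : forall n, carrier (S n) `<=` carrier (S n.+1).
Hypothesis hW : is_completion S iota.

Lemma nested_le m n : (m <= n)%N -> carrier (S m) `<=` carrier (S n).
Proof.
move=> /subnK <-; elim: (n - m)%N => // k IH x /IH; rewrite addSn; exact: nested.
Qed.

Lemma iota_linear n : linear_on (carrier (S n)) iota.
Proof. by have [/(_ n)[]] := hW. Qed.

Lemma iota_norm n x : carrier (S n) x -> `|iota x| = snorm (S n) x.
Proof. by move=> Sx; have [/(_ n)[_ _ /(_ x)]] := hW; rewrite inE => /(_ Sx). Qed.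

Lemma iota_approx y (e : R) : 0 < e ->
  exists n x, carrier (S n) x /\ `|iota x - y| < e.
Proof.
move=> e0; have [_ dW] := hW.
have [||z [yz [x [n _ Sx] xz]]] := dW (ball y e).
- by exists y; exact: ballxx.
- exact: ball_open.
by exists n, x; split=> //; move: yz; rewrite -xz -ball_normE/= distrC.
Qed.

(** It suffices to approximate a basis of X0, since coordinates are bounded by a multiple of the
    norm; this gives one stage and a relative error valid for all of X0. *)
Lemma uniform_approx (X : normedModType R) (X0 : set X) (i : X -> W) (e : R) :
  finite_dimensional X -> lin_closed X0 -> linear_on X0 i -> 0 < e ->
  exists n, forall x, X0 x -> exists u, carrier (S n) u /\ `|iota u - i x| <= e * `|x|.
Proof.
move=> [k [v Xv]] clX0 ilin e0.
have [|m [w X0w]] := subspace_span (v := v) clX0; first by rewrite Xv.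
have [d [h [gfree gspan]]] := free_subfamily w.
set g := w \o h in gfree gspan; rewrite -X0w in gspan.
have X0g l : X0 (g l) by rewrite -gspan; exact: lin_span_gen.
have [||c [c0 hc]] := @row_norm_lower R d (fun v => `|comb g v|).
- split=> [x y _ _|a x _]; first by rewrite combD ler_normD.
  by rewrite combZ normrZ.
- by move=> x /normr0_eq0/gfree.
(* There are d errors to add up; the denominator d + 1 is nonzero also for d = 0. *)
pose e' := e * c / d.+1%:R.
have e'0 : 0 < e' by rewrite divr_gt0// mulr_gt0.
have /choice[f fP] : forall l, exists nu : nat * E,
    carrier (S nu.1) nu.2 /\ `|iota nu.2 - i (g l)| < e'.
  by move=> l; have [n [x []]] := iota_approx (i (g l)) e'0; exists (n, x).
pose n := \max_l (f l).1.
have fn l : carrier (S n) (f l).2.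
  by apply: (nested_le _ (fP l).1); exact: (leq_bigmax (F := fun l => (f l).1)).
exists n => x; rewrite -gspan => /lin_spanP[z xE].
exists (\sum_l z 0 l *: (f l).2); split.
  by apply: (lin_closed_sum (clS n)) => l; exact: (lin_closedZ (clS n)).
rewrite (linear_on_sum (clS n) (@iota_linear n)); last first.
  by move=> l; exact: (lin_closedZ (clS n)).
rewrite xE /comb (linear_on_sum clX0 ilin); last by move=> l; exact: (lin_closedZ clX0).
rewrite -sumrB (le_trans (ler_norm_sum _ _ _))//.
apply: (@le_trans _ _ (\sum_(l < d) `|z| * e')).
  apply: ler_sum => l _; rewrite (linear_onZ (clS n) (@iota_linear n))//.
  rewrite (linear_onZ clX0 ilin)// -scalerBr normrZ ler_pM//; first exact: row_coord_le.
  exact: ltW (fP l).2.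
rewrite sumr_const card_ord -[leLHS]mulr_natr.
have := hc z; rewrite -/(comb g z) => hcz.
have : e * (c * `|z|) <= e * `|comb g z| by rewrite ler_pM2l.
apply: le_trans; rewrite /e'.
have -> : `|z| * (e * c / d.+1%:R) * d%:R = e * (c * `|z|) * (d%:R / d.+1%:R).
  by move: (d.+1%:R^-1) => D; ring.
rewrite ler_piMr ?mulr_ge0 ?(ltW e0) ?(ltW c0)//.
by rewrite ler_pdivrMr// mul1r ler_nat.
Qed.

End Chain.

(** The inequality defines a closed set, which contains the dense image of the chain. *)
Lemma operator_contractive (R : realType) (E E' : lmodType R)
    (W W' : completeNormedModType R) (S : nat -> normed_subspace E)
    (iota : E -> W) (iota' : E' -> W') (F : nat -> E -> E') (G : {linear W -> W'}) :
  is_completion S iota -> continuous G ->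
  (forall n x, carrier (S n) x -> G (iota x) = iota' (F n x)) ->
  (forall n x, carrier (S n) x -> `|iota' (F n x)| <= `|iota x|) ->
  forall y, `|G y| <= `|y|.
Proof.
move=> hW cG hG hF y; rewrite -subr_ge0.
pose A := [set z : W | 0 <= `|z| - `|G z|].
have cA : closed A.
  apply: (preimage_closed (f := fun z : W => `|z| - `|G z|) (D := [set t : R | 0 <= t])).
    move=> z _; apply: continuousB; first exact: norm_continuous.
    by apply: continuous_comp; [exact: cG|exact: norm_continuous].
  exact: closed_ge.
suff : closure A y by move/cA.
move=> B /nbhs_ballP[e e0 eB].
have [n [x [Sx xy]]] := iota_approx hW y e0.
exists (iota x); split; first by rewrite /A/= subr_ge0 (hG n)// hF.
by apply: eB; rewrite -ball_normE/= distrC.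
Qed.

(** * The amalgam norm on the sum of X and a stage of the chain *)

Section Amalgam.
Context {R : realType} {E : lmodType R} {X W : normedModType R}.
Variables (b : nat -> E) (co : nat -> {linear E -> R^o}).
Hypothesis hb : vector_basis b.
Hypothesis coS : forall x, exists n, (forall k, (n <= k)%N -> co k x = 0) /\
  x = \sum_(i < n) (co i x : R) *: b i.
Hypothesis cob : forall k l, co k (b l) = (k == l)%:R.
Variables (S : normed_subspace E) (N a : nat).
Hypothesis Srat : rational_subspace b S.
Hypothesis coN : forall x k, carrier S x -> (N <= k)%N -> co k x = 0.
Variables (iota : E -> W) (X0 : set X) (i : X -> W).
Hypothesis iota_lin : linear_on (carrier S) iota.
Hypothesis iota_iso : forall x, carrier S x -> `|iota x| = snorm S x.
Hypothesis clX0 : lin_closed X0.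
Hypothesis ilin : linear_on X0 i.
Hypothesis iiso : forall x, X0 x -> `|i x| = `|x|.
Variables (phi : {linear 'rV[R]_a -> X}) (psi : {linear X -> 'rV[R]_a}) (de : R).
Hypothesis phiK : cancel phi psi.
Hypothesis psiK : cancel psi phi.
Hypothesis de0 : 0 < de.

Local Notation tl := (tail b N).
Local Notation tc := (tail_coord co N a).
Local Notation hd := (base_part b co N a).
Local Notation extend := (extend b co S N a).

(* The term with de makes the pushout seminorm definite without changing it
   on S. *)
Definition amalgam_norm (x : E) : R :=
  pushout_norm X0 i (phi (tc x)) (iota (hd x)) + de * `|phi (tc x)|.

Let clS := rational_subspace_closed Srat.

Lemma amalgam_seminorm : seminorm_on extend amalgam_norm.
Proof.
split=> [x y Ex Ey|c x Ex]; rewrite /amalgam_norm.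
  have -> : tc (x + y) = tc x + tc y by have := tail_coord_linear co N a 1 x y; rewrite !scale1r.
  rewrite base_partD (linear_onD iota_lin)// linearD.
  have := pushout_normD clX0 ilin (phi (tc x)) (iota (hd x)) (phi (tc y)) (iota (hd y)).
  have := ler_normD (phi (tc x)) (phi (tc y)); rewrite -(ler_pM2l de0) mulrDr; lra.
have -> : tc (c *: x) = c *: tc x.
  have := tail_coord_linear co N a c x 0.
  by rewrite (tail_coord0 _ coN clS.1) !addr0.
rewrite base_partZ (linear_onZ clS iota_lin)// linearZ/= pushout_normZ// normrZ.
by rewrite mulrDr mulrCA.
Qed.

Lemma amalgam_norm_id x : carrier S x -> amalgam_norm x = snorm S x.
Proof.
move=> Sx; rewrite /amalgam_norm (base_part_id _ _ coN Sx) (tail_coord0 _ coN Sx) linear0.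
by rewrite pushout_norm_inr// normr0 mulr0 addr0 iota_iso.
Qed.

Lemma amalgam_norm_tail v : amalgam_norm (tl v) = (1 + de) * `|phi v|.
Proof.
rewrite /amalgam_norm (base_part_tail cob) (tailK cob) (linear_on0 clS iota_lin).
by rewrite pushout_norm_inl// mulrDl mul1r.
Qed.

(** The term with [de] forces the X-component to vanish; what remains lies in S, whose norm is
    definite. *)
Lemma amalgam_norm_eq0 x : extend x -> amalgam_norm x = 0 -> x = 0.
Proof.
move=> Ex; rewrite /amalgam_norm => h0.
have h1 : 0 <= pushout_norm X0 i (phi (tc x)) (iota (hd x)) by exact: pushout_norm_ge0.
have h2 : 0 <= de * `|phi (tc x)| by rewrite mulr_ge0// ltW.
have /eqP : de * `|phi (tc x)| = 0 by lra.
rewrite mulf_eq0 gt_eqF//= normr_eq0 => /eqP phi0.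
have tx : tc x = 0 by rewrite -[LHS]phiK phi0 linear0.
have hx : hd x = x by rewrite /base_part tx tail0 subr0.
have Sx : carrier S x by rewrite -hx.
have [_ /is_normP[_ Sdef] _] := Srat.
by apply: Sdef => //; rewrite -amalgam_norm_id.
Qed.

(** The pushout identifies [phi v] with its image under i, so up to the small extra term the
    distance to u is at most the one measured in W. *)
Lemma amalgam_norm_close v u : X0 (phi v) -> carrier S u ->
  amalgam_norm (tl v - u) <= `|iota u - i (phi v)| + de * `|phi v|.
Proof.
move=> Xv Su; rewrite /amalgam_norm.
have -> : tc (tl v - u) = v.
  by rewrite addrC -scaleN1r tail_coord_linear (tail_coord0 _ coN Su) scaler0 add0r (tailK cob).
have -> : hd (tl v - u) = - u.
  by rewrite addrC -scaleN1r base_part_linear (base_part_id _ _ coN Su) (base_part_tail cob) addr0.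
rewrite (linear_onN clS iota_lin)// lerD2r.
rewrite (le_trans (pushout_norm_amalgam _ _ Xv))//.
by rewrite -normrN opprD opprK.
Qed.

(** On X the norm of S' lies between [1 + de] and [(1 + de) ^+ 2] times the given one, so division
    by the square gives an embedding. The factor depends on [de] alone, hence is shared by the
    domain and the codomain. *)
Lemma amalgam_estimate (S' : normed_subspace E) (h : E -> W) (eps : R) :
    de <= 1 -> 20 * de <= eps ->
    linear_on extend h -> (forall x, extend x -> `|h x| = snorm S' x) ->
    (forall x, carrier S x -> h x = iota x) ->
    (forall x, extend x -> amalgam_norm x <= snorm S' x <= (1 + de) * amalgam_norm x) ->
    (forall x, X0 x -> exists u, carrier S u /\ `|iota u - i x| <= de * `|x|) ->
  exists f : {linear X -> W},
    [/\ forall x, f x = ((1 + de) ^+ 2)^-1 *: h (tl (psi x)), eps_embedding eps f &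
        (opnorm (normed_in X0) (whole W) (f \- i)%R < eps%:E)%E].
Proof.
move=> de1 de20 hlin hiso hS S'am approx.
have Et (v : 'rV[R]_a) : extend (tl v) by exact: (extend_tail cob _ Srat).
have clE := extend_closed co N a Srat.
set s := ((1 + de) ^+ 2)^-1.
have d1 : 0 < 1 + de by rewrite addr_gt0.
have d2 : 0 < (1 + de) ^+ 2 by rewrite exprn_gt0// addr_gt0.
have s0 : 0 < s by rewrite invr_gt0.
have sE : s * (1 + de) ^+ 2 = 1 by rewrite mulVf// gt_eqF.
have flin : linear (fun x => s *: h (tl (psi x))).
  move=> c x y; rewrite linearP /tail comb_linear -/(tl _) -/(tl _).
  by rewrite (linear_onP hlin)// scalerDr !scalerA mulrC.
have [f fE] := exists_linear flin.
have S'b x : (1 + de) * `|x| <= snorm S' (tl (psi x)) <= (1 + de) ^+ 2 * `|x|.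
  have := S'am _ (Et (psi x)); rewrite amalgam_norm_tail psiK.
  by rewrite expr2 -mulrA.
have fnorm x : `|f x| = s * snorm S' (tl (psi x)).
  by rewrite fE normrZ gtr0_norm// hiso.
exists f; split=> //.
  move=> x; rewrite fnorm; have /andP[lo up] := S'b x; split.
    apply: (@le_trans _ _ (s * ((1 + de) * `|x|))); last by rewrite ler_pM2l.
    rewrite mulrA ler_wpM2r//.
    have -> : s * (1 + de) = (1 + de)^-1.
      by rewrite /s expr2 invfM -mulrA mulVf ?mulr1// lt0r_neq0.
    by rewrite lef_pV2 ?posrE//; move: de0; lra.
  have : s * snorm S' (tl (psi x)) <= s * ((1 + de) ^+ 2 * `|x|) by rewrite ler_pM2l.
  by rewrite mulrA sE mul1r.
(* The constant is 3 + 4 + 1: rescaling, the distance from z to u in the norm of S', and the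
   approximation of [i x] by u. *)
apply: (@le_lt_trans _ _ (8 * de)%:E); last by rewrite lte_fin; move: de0; lra.
apply: opnorm_le => /= [|x X0x]; first by rewrite mulr_ge0// ltW.
have [u [Su ux]] := approx x X0x.
have /andP[lo up] := S'b x.
set z := tl (psi x) in lo up *.
have s1 : 0 <= 1 - s by rewrite subr_ge0 invf_le1// exprn_ege1// lerDl ltW.
have a1 : `|h z - f x| <= 3 * de * `|x|.
  rewrite fE -/z -{1}[h z]scale1r -scalerBl normrZ ger0_norm// hiso//; last exact: Et.
  apply: (@le_trans _ _ ((1 - s) * ((1 + de) ^+ 2 * `|x|))); first by rewrite ler_wpM2l.
  rewrite mulrA mulrBl sE mul1r ler_wpM2r//.
  have : de * de <= de by rewrite ler_piMr// ltW.
  by rewrite expr2; move: de0; lra.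
have a2 : `|h z - iota u| <= 4 * de * `|x|.
  have Eu : extend u by exact: (sub_extend _ _ coN).
  have Ez : extend z by exact: Et.
  rewrite -hS// -(linear_onB clE hlin)// hiso; last exact: (lin_closedB clE).
  have /andP[_] := S'am _ (lin_closedB clE Ez Eu).
  have : amalgam_norm (z - u) <= `|iota u - i x| + de * `|x|.
    by have := @amalgam_norm_close (psi x) u; rewrite psiK; exact.
  have am0 : 0 <= amalgam_norm (z - u).
    exact: (seminorm_on_ge0 clE amalgam_seminorm (lin_closedB clE Ez Eu)).
  have : de * amalgam_norm (z - u) <= amalgam_norm (z - u) by rewrite ler_piMl.
  rewrite mulrDl mul1r => h1 h2 h3; lra.
have -> : f x - i x = (f x - h z) + (h z - iota u) + (iota u - i x).
  by rewrite !subrKA.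
rewrite (le_trans (ler_normD _ _))// (le_trans (lerD (ler_normD _ _) (lexx _)))//.
rewrite distrC in a1; lra.
Qed.

End Amalgam.

(** A stage involves finitely many basis vectors, so those of large index are free for a copy of X
    or Y. *)
Lemma bounded_coordinates (R : realType) (E : lmodType R) (b : nat -> E)
    (co : nat -> {linear E -> R^o}) (S : normed_subspace E) :
  (forall x, exists n, (forall k, (n <= k)%N -> co k x = 0) /\
     x = \sum_(i < n) (co i x : R) *: b i) ->
  rational_subspace b S ->
  exists N, forall x k, carrier S x -> (N <= k)%N -> co k x = 0.
Proof.
move=> coS [[n [v [_ ->]]] _ _].
have /choice[m mP] : forall l, exists m, forall k, (m <= k)%N -> co k (v l) = 0.
  by move=> l; have [m [h _]] := coS (v l); exists m.
exists (\max_l m l) => _ k [c ->] Nk; rewrite linear_sum big1// => l _.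
rewrite linearZ/= (mP l) ?scaler0//.
by apply: leq_trans Nk; exact: (leq_bigmax (F := m)).
Qed.

(** * The generic operator *)

Section Main.
Context {R : realType} {U V : lmodType R}.
Variables (bU : nat -> U) (bV : nat -> V).
Hypothesis hbU : vector_basis bU.
Hypothesis hbV : vector_basis bV.
Variable tr : nat -> triple U V.
Hypothesis htr : repeating_enumeration bU bV tr.
Variables (Us : nat -> normed_subspace U) (Vs : nat -> normed_subspace V).
Variable F : nat -> U -> V.
Hypothesis hF : generic_sequence bU bV tr Us Vs F.
Variables (Uinf Vinf : completeNormedModType R) (iU : U -> Uinf) (iV : V -> Vinf).
Hypothesis hU : is_completion Us iU.
Hypothesis hV : is_completion Vs iV.
Variable Finf : {linear Uinf -> Vinf}.
Hypothesis cFinf : continuous Finf.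
Hypothesis hFinf : forall n, {in carrier (Us n), Finf \o iU =1 iV \o F n}.

Lemma Us_rational n : rational_subspace bU (Us n).
Proof. by have [/(_ n)[]] := hF. Qed.

Lemma Vs_rational n : rational_subspace bV (Vs n).
Proof. by have [/(_ n)[]] := hF. Qed.

Lemma F_rational n : rational_operator bU bV (Us n) (Vs n) (F n).
Proof. by have [/(_ n)[]] := hF. Qed.

Let clUs n := rational_subspace_closed (Us_rational n).
Let clVs n := rational_subspace_closed (Vs_rational n).

Lemma F_carrier n x : carrier (Us n) x -> carrier (Vs n) (F n x).
Proof. by move=> Ux; have [[FV _ _] _] := F_rational n; apply: FV; exists x. Qed.

Lemma F_contractive n x : carrier (Us n) x -> snorm (Vs n) (F n x) <= snorm (Us n) x.
Proof.
have [_ nU _] := Us_rational n; have [_ nV _] := Vs_rational n.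
exact: (opnorm_le1 (clUs n) (clVs n) nU nV (F_rational n).1).
Qed.

Lemma carriers_nested n : carrier (Us n) `<=` carrier (Us n.+1) /\
  carrier (Vs n) `<=` carrier (Vs n.+1).
Proof.
have [_ _ hstep hidle] := hF.
have [hc|hc] := pselect (condition_star tr Us Vs F n.+1).
  have [[[[hUn _ _] _] _] [[[hVn _ _] _] _] _ _] := hstep n.+1 isT hc.
  by split=> x Sx; [apply: hUn; exists x|apply: hVn; exists x].
have [[cU _] [cV _] _] := hidle n.+1 isT hc.
by rewrite cU cV; split.
Qed.

Lemma Finf_iU n x : carrier (Us n) x -> Finf (iU x) = iV (F n x).
Proof. by move=> Ux; apply: (hFinf (n := n)); rewrite inE. Qed.

Lemma Finf_contractive y : `|Finf y| <= `|y|.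
Proof.
apply: (operator_contractive hU cFinf Finf_iU) => n x Ux.
by rewrite (iota_norm hV (F_carrier Ux)) (iota_norm hU Ux); exact: F_contractive.
Qed.

(** Infinite repetition is what makes a triple referring to stage n come up after n. *)
Lemma late_index n t : triple_family bU bV t ->
  exists m, (n < m)%N /\ eq_triple (tr m) t.
Proof.
move=> /(htr.2) tinf; apply: contrapT => /forallNP h; apply: tinf.
apply: (sub_finite_set _ (finite_II n.+1)) => m mt /=.
by rewrite ltnS leqNgt; apply/negP => nm; apply: (h m).
Qed.

(** The extension, with inclusions as embeddings and n as its number, is a triple of the family. At
    a later stage where it is listed the condition for a pushout step holds, and the maps i', j' of
    that step followed by [iU], [iV] are as required; commutativity of the squares gives agreement
    on stage n. *)
Lemma extension_step n (SU : normed_subspace U) (SV : normed_subspace V) (f : U -> V) :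
  rational_subspace bU SU -> rational_subspace bV SV ->
  rational_operator bU bV SU SV f ->
  rational_embedding bU bU (Us n) SU id -> rational_embedding bV bV (Vs n) SV id ->
  (forall x, carrier (Us n) x -> f x = F n x) ->
  exists (h : U -> Uinf) (h' : V -> Vinf),
    [/\ [/\ linear_on (carrier SU) h, forall x, carrier SU x -> `|h x| = snorm SU x &
            forall x, carrier (Us n) x -> h x = iU x],
        [/\ linear_on (carrier SV) h', forall x, carrier SV x -> `|h' x| = snorm SV x &
            forall x, carrier (Vs n) x -> h' x = iV x] &
        forall x, carrier SU x -> Finf (h x) = h' (f x)].
Proof.
move=> SUrat SVrat frat eU eV fF.
pose t := Triple SU SV f (Us n) (Vs n) id id n.
have [|m [nm]] := @late_index n t.
  by split=> //=; split; [exact: Us_rational|exact: Vs_rational].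
move=> [/= [[cX sX] [cY sY]] eT [[cX0 sX0] [cY0 sY0]] [eti etj] ek].
have UsSU x : carrier (Us n) x -> carrier SU x.
  by move=> Ux; have [[[h _ _] _] _] := eU; apply: h; exists x.
have VsSV x : carrier (Vs n) x -> carrier SV x.
  by move=> Vx; have [[[h _ _] _] _] := eV; apply: h; exists x.
(* The enumeration lists the triple only up to [eq_triple], so values and norms are transported on
   the carriers. *)
have hti x : carrier (Us n) x -> ti (tr m) x = x by move=> Ux; apply: eti; rewrite cX0 inE.
have htj x : carrier (Vs n) x -> tj (tr m) x = x by move=> Vx; apply: etj; rewrite cY0 inE.
have htT x : carrier SU x -> tT (tr m) x = f x by move=> Ux; apply: eT; rewrite cX inE.
have star : condition_star tr Us Vs F m.
  rewrite /condition_star ek; split=> // x; rewrite inE => Ux /=.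
  by rewrite hti// (htT _ (UsSU _ Ux)) fF// (htj _ (F_carrier Ux)).
have [_ _ hstep _] := hF.
have [_ _ _ [i' [j' [ri' [_ _ pi' _] rj' [_ _ pj' _] Fi']]]] :=
  hstep m (leq_ltn_trans (leq0n n) nm) star.
rewrite ek in pi' pj'.
have [_ [i'U i'lin i'iso]] := ri'; have [_ [j'V j'lin j'iso]] := rj'.
rewrite cX in i'U i'lin i'iso Fi'; rewrite cY in j'V j'lin j'iso.
have i'C x : carrier SU x -> carrier (Us m) (i' x) by move=> Sx; apply: i'U; exists x.
have j'C x : carrier SV x -> carrier (Vs m) (j' x) by move=> Sx; apply: j'V; exists x.
have lU := iota_linear hU (n := m); have lV := iota_linear hV (n := m).
exists (iU \o i'), (iV \o j'); split; first split.
- move=> a x y; rewrite !inE => Sx Sy /=.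
  by rewrite (linear_onP i'lin)// (linear_onP lU)//; exact: i'C.
- move=> x Sx /=; rewrite (iota_norm hU (i'C x Sx)) i'iso ?inE//.
  by apply: sX; rewrite cX inE.
- move=> x Ux /=; congr iU.
  by have := pi' x; rewrite inE /= hti//; exact.
- split.
  + move=> a x y; rewrite !inE => Sx Sy /=.
    by rewrite (linear_onP j'lin)// (linear_onP lV)//; exact: j'C.
  + move=> x Sx /=; rewrite (iota_norm hV (j'C x Sx)) j'iso ?inE//.
    by apply: sY; rewrite cY inE.
  + move=> x Vx /=; congr iV.
    by have := pj' x; rewrite inE /= htj//; exact.
- move=> x Sx /=; rewrite (Finf_iU (i'C x Sx)); congr iV.
  by have := Fi' x; rewrite inE /= htT//; exact.
Qed.

Lemma generic_Gstar : condition_Gstar Finf.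
Proof.
move=> eps X Y T X0 Y0 i j eps0 [[fdX fdY] Tne [sX0 sY0 TX0] [iemb jemb] comm].
have clX0 : lin_closed X0.
  have [h0 h1] := sX0; split; first by have := h0; rewrite inE.
  by move=> a x y Xx Xy; have := h1 a x y; rewrite !inE; exact.
have clY0 : lin_closed Y0.
  have [h0 h1] := sY0; split; first by have := h0; rewrite inE.
  by move=> a x y Xx Xy; have := h1 a x y; rewrite !inE; exact.
have [_ ilin iiso'] := iemb; have [_ jlin jiso'] := jemb.
have iiso x : X0 x -> `|i x| = `|x| by move=> Xx; apply: iiso'; rewrite inE.
have jiso x : Y0 x -> `|j x| = `|x| by move=> Xx; apply: jiso'; rewrite inE.
have Tle x : `|T x| <= `|x|.
  exact: (@opnorm_le1 _ _ _ _ _ T x (whole_closed X) (whole_closed Y)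
           (whole_norm X) (whole_norm Y) Tne I).
have TXY x : X0 x -> Y0 (T x) by move=> Xx; apply: TX0; exists x.
have Fi x : X0 x -> Finf (i x) = j (T x) by move=> Xx; apply: comm; rewrite inE.
(* The bound 1 absorbs squares of [de], and [eps / 20] covers the final estimates. *)
pose de := Num.min 1 (eps / 20).
have de0 : 0 < de by rewrite lt_min ltr01 divr_gt0.
have de1 : de <= 1 by rewrite ge_min lexx.
have de20 : 20 * de <= eps.
  by rewrite mulrC -ler_pdivlMr// ge_min lexx orbT.
have nU n := (carriers_nested n).1; have nV n := (carriers_nested n).2.
have [n1 hn1] := uniform_approx clUs nU hU fdX clX0 ilin de0.
have [n2 hn2] := uniform_approx clVs nV hV fdY clY0 jlin de0.
pose n := maxn n1 n2.
have apU x : X0 x -> exists u, carrier (Us n) u /\ `|iU u - i x| <= de * `|x|.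
  move=> /hn1[u [Uu hu]]; exists u; split=> //.
  by apply: (nested_le nU _ Uu); exact: leq_maxl.
have apV x : Y0 x -> exists u, carrier (Vs n) u /\ `|iV u - j x| <= de * `|x|.
  move=> /hn2[u [Uu hu]]; exists u; split=> //.
  by apply: (nested_le nV _ Uu); exact: leq_maxr.
have [a [c [r [phi [psi [phi' [psi' [phiK psiK phi'K psi'K TE]]]]]]]] :=
  adapted_coordinates T fdX fdY.
have [cu [cuS cub]] := basis_coordinates hbU.
have [cv [cvS cvb]] := basis_coordinates hbV.
have Urat := Us_rational n; have Vrat := Vs_rational n.
have [N hN] := bounded_coordinates cuS Urat.
have [N' hN'] := bounded_coordinates cvS Vrat.
have lU := iota_linear hU (n := n); have lV := iota_linear hV (n := n).
have isU := iota_norm hU (n := n); have isV := iota_norm hV (n := n).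
have clEU := extend_closed cu N a Urat; have clEV := extend_closed cv N' c Vrat.
set EU := extend bU cu (Us n) N a in clEU *.
set EV := extend bV cv (Vs n) N' c in clEV *.
pose pU := amalgam_norm bU cu N iU X0 i phi de.
pose pV := amalgam_norm bV cv N' iV Y0 j phi' de.
have psU : seminorm_on EU pU := amalgam_seminorm Urat hN lU clX0 ilin iiso phi de0.
have psV : seminorm_on EV pV := amalgam_seminorm Vrat hN' lV clY0 jlin jiso phi' de0.
have pU0 x : EU x -> pU x = 0 -> x = 0.
  exact: (amalgam_norm_eq0 Urat hN isU clX0 ilin iiso phiK de0).
have pV0 x : EV x -> pV x = 0 -> x = 0.
  exact: (amalgam_norm_eq0 Vrat hN' isV clY0 jlin jiso phi'K de0).
have pUS x : carrier (Us n) x -> pU x = snorm (Us n) x.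
  exact: (amalgam_norm_id _ hN isU clX0 ilin iiso).
have pVS x : carrier (Vs n) x -> pV x = snorm (Vs n) x.
  exact: (amalgam_norm_id _ hN' isV clY0 jlin jiso).
(* The domain is treated first, with no prescribed points; its net then prescribes points for the
   codomain. *)
have nilP w : w \in ([::] : seq U) -> [/\ EU w, rational_vector bU w & pU w <= 1] by [].
have [SU [wsU [cSU SUrat SUp SUS [wsUP _ SUmax]]]] :=
  rationalise hbU cuS cub Urat hN psU pU0 pUS de0 nilP.
pose A : 'M[R]_(a, c) := pid_mx r.
(* The sum of [F n] and T, the latter written in adapted coordinates, where its matrix has entries 0
   and 1. *)
pose G x := F n (base_part bU cu N a x) + tail bV N' (tail_coord cu N a x *m A).
have [[FnV Fnlin _] Fnrat] := F_rational n.
have Gtail v : G (tail bU N v) = tail bV N' (v *m A).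
  by rewrite /G (base_part_tail cub) (linear_on0 (clUs n) Fnlin) add0r (tailK cub).
have GF x : carrier (Us n) x -> G x = F n x.
  move=> Ux; rewrite /G (base_part_id _ _ hN Ux) (tail_coord0 _ hN Ux) mul0mx.
  by rewrite tail0 addr0.
have Gbase x : EU x -> base_part bV cv N' c (G x) = F n (base_part bU cu N a x).
  move=> Ex; rewrite /G base_partD (base_part_tail cvb) addr0.
  exact: (base_part_id _ _ hN' (F_carrier Ex)).
have Gcoord x : EU x -> tail_coord cv N' c (G x) = tail_coord cu N a x *m A.
  move=> Ex; rewrite /G -[F n _]scale1r tail_coord_linear (tailK cvb).
  by rewrite (tail_coord0 _ hN' (F_carrier Ex)) scaler0 add0r.
have GE x : EU x -> EV (G x).
  by move=> Ex; rewrite /EV /extend/= Gbase//; exact: F_carrier.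
have Glin : linear_on EU G.
  move=> k x y; rewrite !inE => Ex Ey; rewrite /G base_part_linear (linear_onP Fnlin)//.
  rewrite tail_coord_linear mulmxDl -scalemxAl /tail comb_linear.
  by rewrite scalerDr addrACA.
have Grat x : EU x -> rational_vector bU x -> rational_vector bV (G x).
  move=> Ex xr; apply/(rational_vectorP cvS cvb) => k; rewrite linearD.
  apply: rationalD; apply: (rational_vectorP cvS cvb _).1.
    by apply: Fnrat => //; exact: (rational_base_part hbU cuS cub).
  apply: (rational_tail hbV) => l; rewrite mxE; elim/big_ind : _ => //.
  - exact: rational0.
  - exact: rationalD.
  - move=> q _; apply: rationalM; first exact: (rational_tail_coord cuS cub).
    by rewrite mxE; exact: rational_nat.
(* Both summands decrease: the pushout norm by functoriality, the extra term because T is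
   nonexpansive and both norms use the same [de]. *)
have pGle x : EU x -> pV (G x) <= pU x.
  move=> Ex; rewrite /pV /amalgam_norm Gbase// Gcoord// -TE -(Finf_iU Ex).
  apply: lerD; last by rewrite ler_pM2l.
  exact: pushout_norm_map Finf_contractive TXY Fi.
have wsVP w : w \in map G wsU -> [/\ EV w, rational_vector bV w & pV w <= 1].
  move=> /mapP[z /wsUP[Ez zr pz] ->]; split; [exact: GE|exact: Grat|].
  exact: le_trans (pGle _ Ez) pz.
have [SV [wsV [cSV SVrat SVp SVS [_ SVws _]]]] :=
  rationalise hbV cvS cvb Vrat hN' psV pV0 pVS de0 wsVP.
have [_ nSU _] := SUrat; have [_ nSV _] := SVrat.
have [sSU _] := (is_normP SU).1 nSU; have [sSV _] := (is_normP SV).1 nSV.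
rewrite cSU in sSU; rewrite cSV in sSV.
have Gle x : EU x -> snorm SV (G x) <= snorm SU x.
  (* Maximality of the norm on [SU], applied to the norm of [SV] pulled back along G. It is at most
     1 on the net because the images of the net were prescribed, and below [2 * pU] because [1 + de]
     is at most 2. *)
  apply: (SUmax (fun x => snorm SV (G x))).
  - split=> [y z Ey Ez|k y Ey].
      by rewrite (linear_onD Glin)//; apply: sSV.1; exact: GE.
    by rewrite (linear_onZ clEU Glin)//; apply: sSV.2; exact: GE.
  - move=> y Uy; rewrite GF// SVS; last exact: F_carrier.
    exact: F_contractive.
  - move=> y Ey; have /andP[_] := SVp _ (GE _ Ey).
    have := pGle y Ey; have := seminorm_on_ge0 clEV psV (GE _ Ey).
    rewrite mulrDl mul1r => h1 h2 h3.
    have : de * pV (G y) <= pV (G y) by rewrite ler_piMl.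
    move: h1 h2 h3; rewrite -/(pV _); lra.
  - by move=> w hw; apply: SVws; exact: map_f.
have Gop : rational_operator bU bV SU SV G.
  split; last by rewrite cSU.
  split; rewrite ?cSU ?cSV.
  - by move=> _ [x Ex <-]; exact: GE.
  - exact: Glin.
  - by apply: opnorm_le => //; rewrite cSU => x Ex; rewrite mul1r; exact: Gle.
have emb (E : lmodType R) (b : nat -> E) (S S' : normed_subspace E) :
    carrier S `<=` carrier S' ->
    (forall x, carrier S x -> snorm S' x = snorm S x) -> rational_embedding b b S S' id.
  move=> SS' eS; split; last by split=> [_ [x Sx <-]||x]; rewrite ?inE; auto.
  split=> //; split=> //; first by move=> _ [x Sx <-]; exact: SS'.
  by apply: opnorm_le => // x Sx; rewrite mul1r eS.
have [||h [h' [[hlin hiso hU'] [h'lin h'iso hV'] hh']]] :=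
  extension_step SUrat SVrat Gop _ _ GF.
- by apply: emb => //; rewrite cSU => x Ux; exact: (sub_extend _ _ hN).
- by apply: emb => //; rewrite cSV => x Ux; exact: (sub_extend _ _ hN').
rewrite cSU in hlin hiso hh'; rewrite cSV in h'lin h'iso.
have [f [fE femb fcl]] := amalgam_estimate cub Urat hN lU clX0 ilin iiso psiK de0
  de1 de20 hlin hiso hU' SUp apU.
have [g [gE gemb gcl]] := amalgam_estimate cvb Vrat hN' lV clY0 jlin jiso psi'K de0
  de1 de20 h'lin h'iso hV' SVp apV.
(* Both maps carry the same scalar factor, so the exact relation between h and h' passes to them. *)
exists f, g; split=> // x /=; rewrite fE gE linearZ/=; congr (_ *: _).
rewrite hh'; last exact: (extend_tail cub _ Urat).
by rewrite Gtail -{2}(psiK x) TE phi'K.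
Qed.

End Main.

Theorem proposition3p1 (R : realType)
  (U V : lmodType R) (bU : nat -> U) (bV : nat -> V)
  (hbU : vector_basis bU) (hbV : vector_basis bV)
  (tr : nat -> triple U V) (htr : repeating_enumeration bU bV tr)
  (Us : nat -> normed_subspace U) (Vs : nat -> normed_subspace V)
  (F : nat -> U -> V) (hF : generic_sequence bU bV tr Us Vs F)
  (Uinf Vinf : completeNormedModType R)
  (iU : U -> Uinf) (hU : is_completion Us iU)
  (iV : V -> Vinf) (hV : is_completion Vs iV)
  (Finf : {linear Uinf -> Vinf}) (cFinf : continuous Finf)
  (hFinf : forall n, {in carrier (Us n), Finf \o iU =1 iV \o F n}) :
  condition_Gstar Finf /\ gurarii_property Finf.
Proof.
have Gstar := generic_Gstar hbU hbV htr hF hU hV cFinf hFinf.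
split=> //; split.
  apply: opnorm_le => // x _; rewrite mul1r.
  exact: (Finf_contractive hF hU hV cFinf hFinf).
move=> eps X Y T X0 Y0 i j eps0 /(Gstar _ _ _ _ _ _ _ _ eps0)[i' [j' [? ? ? ? ij]]].
exists i', j'; split=> //.
(* Exact intertwining makes the difference vanish, so its operator norm is at most 0. *)
apply: (@le_lt_trans _ _ 0%:E); last by rewrite lte_fin.
apply: opnorm_le => // x _; rewrite mul0r /=.
by have := ij x; rewrite /= => ->; rewrite subrr normr0.
Qed.
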